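(* Let $\mathcal{A}\in\mathcal{H}(s_{i,j})$ be a complete hypertetrahedral arrangement in $\mathbb{P}^n$. Then $\mathcal{A}$ is locally free if and only if for each (nonempty) $X\in L(\mathcal{A})$ the arrangement $\mathcal{A}_{W_X}$ is free and the graph $\Gamma_X$ is chordal.
   Context: $\Bbbk$ is an algebraically closed field of characteristic $0$, $R=\Bbbk[x_0,\dots,x_n]$, $\mathbb{P}^n=\mathrm{Proj}(R)$. A hyperplane arrangement $\mathcal{A}$ is a finite (possibly empty) set of distinct hyperplanes in $\mathbb{P}^n$; $f_{\mathcal{A}}$ denotes the product of linear forms defining its hyperplanes ($f=1$ for the empty arrangement). $\mathrm{Der}(-\log\mathcal{A})=\{\theta\in \mathrm{Der}_{\Bbbk}(R): \theta(f_{\mathcal{A}})\in (f_{\mathcal{A}})\}$, $\theta_E=\sum_i x_i\partial_{x_i}$ is the Euler derivation, $\mathrm{Der}(-\log\mathcal{A})_0$ is the quotient of $\mathrm{Der}(-\log\mathcal{A})$ by $R\theta_E$, and $\mathcal{T}_{\mathcal{A}}$ is the sheaf on $\mathbb{P}^n$ associated to $\mathrm{Der}(-\log\mathcal{A})_0$. $\mathcal{A}$ is free if $\mathrm{Der}(-\log\mathcal{A})$ is a free $R$-module (of rank $n+1$), and locally free if $\mathcal{T}_{\mathcal{A}}$ is a locally free sheaf. For $0\le i<j\le n$ let $\mathcal{L}_{i,j}=\{x_i=x_j=0\}$. A hypertetrahedral arrangement in $\mathbb{P}^n$ is one in which every hyperplane contains some $\mathcal{L}_{i,j}$; it is complete if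 it contains all coordinate hyperplanes $\{x_i=0\}$, $0\le i\le n$. For integers $s_{i,j}\ge 1$ ($0\le i<j\le n$), $\mathcal{H}(s_{i,j})$ is the set of complete hypertetrahedral arrangements with exactly $s_{i,j}+2$ hyperplanes through $\mathcal{L}_{i,j}$ for all $i<j$. So $\mathcal{A}\in\mathcal{H}(s_{i,j})$ consists of the coordinate hyperplanes and, for each $i<j$, of $s_{i,j}$ distinct ''inner'' hyperplanes $\{a x_i+b x_j=0\}$ with $a,b\ne 0$. $L(\mathcal{A})$ is the set of intersections of nonempty subcollections of hyperplanes of $\mathcal{A}$ (only nonempty linear subspaces of $\mathbb{P}^n$ are considered). For $X\in L(\mathcal{A})$, $\mathcal{A}_X=\{H\in\mathcal{A}: X\subset H\}$. Supports: an inner hyperplane $\{ax_i+bx_j=0\}$ has support $\{x_i,x_j\}$, the hyperplane $\{x_i=0\}$ has support $\{x_i\}$, and the support of a subarrangement is the union of the supports of its hyperplanes. $W_X$ is the intersection of all coordinate hyperplanes containing $X$; if $X$ lies in no coordinate hyperplane, $W_X:=\emptyset$ and $\mathcal{A}_{W_X}$ is the empty arrangement (which is free). (If $W_X$ is an intersection of $j$ coordinate hyperplanes, $\mathcal{A}_{W_X}$ may be viewed, in the $j$ corresponding variables, as a complete hypertetrahedral arrangement in $\mathbb{P}^{j-1}$; its freeness is the same in either ambient space.) Graph $\Gamma_X$: let $\mathcal{A}_X-\mathcal{A}_{W_X}$ denote set difference. If it is nonempty with support $\{x_{i_0},\dots,x_{i_k}\}$, then $\Gamma_X$ is the graph with vertex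 set $\{i_0,\dots,i_k\}$ and with an edge $(i_l,i_m)$ whenever some $H\in\mathcal{A}_X-\mathcal{A}_{W_X}$ has support $\{x_{i_l},x_{i_m}\}$; if $X=W_X$, $\Gamma_X:=\emptyset$. A graph is chordal if every cycle of length at least $4$ has a chord, i.e. an edge not in the cycle joining two vertices of the cycle; the empty graph is chordal. *)

(* Defs.v *)
From mathcomp Require Import all_boot all_order all_algebra.
From mathcomp Require Export mpoly.

Set Implicit Arguments.
Unset Strict Implicit.
Unset Printing Implicit Defensive.

Import GRing.Theory.

Local Open Scope ring_scope.

Section Proj.

Variables (k : closedFieldType) (n : nat).
Local Notation R := {mpoly k[n.+1]}.

(* The points of Proj R: homogeneous prime ideals, closed under taking
   homogeneous components, not containing all the variables. *)
Record proj_point := ProjPoint {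
  in_ideal :> R -> Prop;
  ideal0 : in_ideal 0;
  idealD : forall f g, in_ideal f -> in_ideal g -> in_ideal (f + g);
  idealM : forall f g, in_ideal g -> in_ideal (f * g);
  ideal_homogeneous :
    forall d f, in_ideal f -> in_ideal (pihomog mdeg d f);
  ideal_proper : ~ in_ideal 1;
  ideal_prime :
    forall f g, in_ideal (f * g) -> in_ideal f \/ in_ideal g;
  ideal_relevant : exists i : 'I_n.+1, ~ in_ideal 'X_i
}.

(* U is the complement of V(I), where I is the ideal generated by the set S of
   homogeneous polynomials. *)
Definition proj_open (U : proj_point -> Prop) : Prop :=
  exists S : R -> Prop, (forall f, S f -> f \is homog mdeg) /\
    (forall p, U p <-> exists2 f, S f & ~ p f).

(* A graded R-module presented as a quotient N / K: [gpiece d] is the part of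
   degree d of N and [grel] is K.  Only the degrees d >= 0 are recorded, because
   the fractions below have a denominator in R. *)
Record graded_module := GradedModule {
  gcarrier : lmodType R;
  gpiece : nat -> gcarrier -> Prop;
  grel : gcarrier -> Prop
}.

Section Sheaf.

Variable M : graded_module.

(* (u, t) stands for u / t. *)
Definition fraction : Type := (gcarrier M * R)%type.

(* x represents an element of M_(p), the degree 0 part of the localization of M
   at the homogeneous polynomials outside p. *)
Definition stalk_elt (p : proj_point) (x : fraction) : Prop :=
  exists d, [/\ gpiece d x.1, x.2 \is d.-homog & ~ p x.2].

Definition stalk_eq (p : proj_point) (x y : fraction) : Prop :=
  exists w, [/\ w \is homog mdeg, ~ p w & grel (w *: (y.2 *: x.1 - x.2 *: y.1))].

(* s represents a section over U of the sheaf associated to M: a function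
   p |-> s p in M_(p) that is locally a single fraction.  Its values outside U
   are irrelevant, and two sections are equal when [section_eq] holds. *)
Definition is_section (U : proj_point -> Prop) (s : proj_point -> fraction) :
    Prop :=
  (forall p, U p -> stalk_elt p (s p)) /\
  (forall p, U p -> exists V : proj_point -> Prop,
     [/\ proj_open V, V p, (forall q, V q -> U q) &
       exists x, forall q, V q -> stalk_elt q x /\ stalk_eq q (s q) x]).

Definition section_eq (U : proj_point -> Prop) (s t : proj_point -> fraction) :
    Prop :=
  forall p, U p -> stalk_eq p (s p) (t p).

Definition fraction_add (x y : fraction) : fraction :=
  (y.2 *: x.1 + x.2 *: y.1, x.2 * y.2).

End Sheaf.

(* R as a module over itself; the associated sheaf is the structure sheaf. *)
Definition structure_module : graded_module :=
  @GradedModule R^o (fun d (f : R) => f \is d.-homog) (fun f => f = 0).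

Definition fraction_scale (M : graded_module) (c : fraction structure_module)
    (x : fraction M) : fraction M :=
  ((c.1 : R) *: x.1, c.2 * x.2).

Definition section_comb (M : graded_module) (r : nat)
    (c : 'I_r -> proj_point -> fraction structure_module)
    (e : 'I_r -> proj_point -> fraction M) : proj_point -> fraction M :=
  fun p => \big[@fraction_add M/(0, 1)]_(i < r) fraction_scale (c i p) (e i p).

(* The restriction to U of the sheaf associated to M is isomorphic to O_U^r:
   e is the image of the standard basis under such an isomorphism. *)
Definition free_sheaf_on (M : graded_module) (U : proj_point -> Prop)
    (r : nat) : Prop :=
  exists e : 'I_r -> proj_point -> fraction M,
    (forall i, is_section U (e i)) /\
    forall V : proj_point -> Prop, proj_open V -> (forall p, V p -> U p) ->
    forall s : proj_point -> fraction M, is_section V s ->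
    exists c : 'I_r -> proj_point -> fraction structure_module,
      [/\ forall i, is_section V (c i),
          section_eq V s (section_comb c e) &
          forall c' : 'I_r -> proj_point -> fraction structure_module,
            (forall i, is_section V (c' i)) ->
            section_eq V s (section_comb c' e) ->
            forall i, section_eq V (c i) (c' i)].

Definition locally_free_sheaf (M : graded_module) : Prop :=
  forall p : proj_point, exists U : proj_point -> Prop,
    [/\ proj_open U, U p & exists r, free_sheaf_on M U r].

End Proj.

Section Arrangements.

Variables (k : closedFieldType) (n : nat).
Local Notation R := {mpoly k[n.+1]}.

(* Linear subspaces of P^n are subspaces of k^(n+1); the empty one is 0.  The
   row vector a stands for the linear form sum_i a_i x_i. *)
Definition hyperplane (a : 'rV[k]_n.+1) : {vspace 'rV[k]_n.+1} :=
  lker (linfun (mulmxr a^T : 'rV[k]_n.+1 -> 'rV[k]_1)).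

Definition coord_hyperplane (i : 'I_n.+1) : {vspace 'rV[k]_n.+1} :=
  hyperplane (delta_mx 0 i).

Definition linear_form (a : 'rV[k]_n.+1) : R := \sum_(i < n.+1) a 0 i *: 'X_i.

(* An arrangement is given by a list of defining linear forms of its
   hyperplanes, one for each hyperplane. *)
Definition arrangement (A : seq 'rV[k]_n.+1) : bool :=
  all (fun a => a != 0) A && uniq [seq hyperplane a | a <- A].

Definition defining_poly (A : seq 'rV[k]_n.+1) : R :=
  \prod_(a <- A) linear_form a.

(* Der_k(R) is free on the partial derivatives: theta stands for the derivation
   sum_i theta_i d/dx_i. *)
Definition der_apply (theta : 'rV[R]_n.+1) (f : R) : R :=
  \sum_(i < n.+1) theta 0 i * f^`M(i).

Definition euler : 'rV[R]_n.+1 := \row_(i < n.+1) 'X_i.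

Definition Der_log (A : seq 'rV[k]_n.+1) (theta : 'rV[R]_n.+1) : Prop :=
  exists g : R, der_apply theta (defining_poly A) = g * defining_poly A.

(* Der(-log A) is free of rank n+1, with basis B. *)
Definition free_arrangement (A : seq 'rV[k]_n.+1) : Prop :=
  exists B : 'I_n.+1 -> 'rV[R]_n.+1,
    (forall i, Der_log A (B i)) /\
    forall theta, Der_log A theta ->
      exists! c : {ffun 'I_n.+1 -> R}, theta = \sum_(i < n.+1) c i *: B i.

(* Der(-log A) / R theta_E.  The d/dx_i have degree -1, so a derivation of
   degree d has coefficients of degree d+1. *)
Definition Der_log0 (A : seq 'rV[k]_n.+1) : graded_module k n :=
  @GradedModule k n 'rV[R]_n.+1
    (fun d theta =>
       Der_log A theta /\ forall i, theta 0 i \is d.+1.-homog)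
    (fun theta => exists c : R, theta = c *: euler).

Definition locally_free_arrangement (A : seq 'rV[k]_n.+1) : Prop :=
  locally_free_sheaf (Der_log0 A).

Definition coord_codim2 (i j : 'I_n.+1) : {vspace 'rV[k]_n.+1} :=
  (coord_hyperplane i :&: coord_hyperplane j)%VS.

Definition hypertetrahedral (A : seq 'rV[k]_n.+1) : Prop :=
  arrangement A /\
  forall a, a \in A ->
    exists i j : 'I_n.+1, (i < j)%N /\ (coord_codim2 i j <= hyperplane a)%VS.

Definition complete_hypertetrahedral (A : seq 'rV[k]_n.+1) : Prop :=
  hypertetrahedral A /\
  forall i, coord_hyperplane i \in [seq hyperplane a | a <- A].

Definition localization (A : seq 'rV[k]_n.+1) (X : {vspace 'rV[k]_n.+1}) :
    seq 'rV[k]_n.+1 :=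
  [seq a <- A | (X <= hyperplane a)%VS].

Definition hypertetrahedral_class (s : 'I_n.+1 -> 'I_n.+1 -> nat)
    (A : seq 'rV[k]_n.+1) : Prop :=
  complete_hypertetrahedral A /\
  forall i j : 'I_n.+1, (i < j)%N ->
    size (localization A (coord_codim2 i j)) = (s i j + 2)%N.

(* L(A); the empty subspace of P^n is excluded. *)
Definition intersection_lattice (A : seq 'rV[k]_n.+1)
    (X : {vspace 'rV[k]_n.+1}) : Prop :=
  exists B : seq 'rV[k]_n.+1, [/\ B != [::], {subset B <= A},
    X = (\bigcap_(b <- B) hyperplane b)%VS & X != 0%VS].

(* W_X; the whole space when no coordinate hyperplane contains X. *)
Definition coord_hull (X : {vspace 'rV[k]_n.+1}) : {vspace 'rV[k]_n.+1} :=
  (\bigcap_(i < n.+1 | (X <= coord_hyperplane i)%VS) coord_hyperplane i)%VS.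

(* A_{W_X}; empty when no coordinate hyperplane contains X. *)
Definition localization_W (A : seq 'rV[k]_n.+1) (X : {vspace 'rV[k]_n.+1}) :
    seq 'rV[k]_n.+1 :=
  if [exists i, X <= coord_hyperplane i]%VS then localization A (coord_hull X)
  else [::].

Definition support (a : 'rV[k]_n.+1) : {set 'I_n.+1} := [set i | a 0 i != 0].

End Arrangements.

Record graph (T : finType) := Graph {
  vertices : {set T};
  edge : rel T
}.

(* The last two conditions say that xy is not an edge of the cycle c. *)
Definition chordal (T : finType) (G : graph T) : Prop :=
  forall c : seq T, {subset c <= vertices G} -> ucycle (edge G) c ->
    (4 <= size c)%N ->
    exists x y, [/\ x \in c, y \in c, edge G x y, y != next c x & x != next c y].

Section Gamma.

Variables (k : closedFieldType) (n : nat).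

(* A_X - A_{W_X} *)
Definition Gamma_members (A : seq 'rV[k]_n.+1) (X : {vspace 'rV[k]_n.+1}) :
    seq 'rV[k]_n.+1 :=
  [seq a <- localization A X | a \notin localization_W A X].

Definition Gamma (A : seq 'rV[k]_n.+1) (X : {vspace 'rV[k]_n.+1}) :
    graph 'I_n.+1 :=
  Graph (\bigcup_(a <- Gamma_members A X) support a)
    (fun i j => (i != j) &&
       has (fun a => support a == [set i; j]) (Gamma_members A X)).

End Gamma.

(* Main.v *)
(* The sheaf T_A is locally free iff A_X is free for every nonempty flat X.  If
   T_A is locally free, then at a generic point of X the module Der(-log A), hence
   Der(-log A_X), is locally generated by n+1 derivations; translating the point to
   the origin and taking homogeneous components yields n+1 global generators, that
   is, a basis.  Conversely a homogeneous basis of Der(-log A_X) contains, locally,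
   an element that can be exchanged for the Euler derivation, and the others
   trivialise T_A.

   The hyperplanes of A_X - A_{W_X} involve only variables not vanishing on X, and
   after rescaling these variables by a general point of X they form the graphic
   arrangement of Gamma_X.  A chordless cycle of length m >= 4 is a localization of
   A that is a generic arrangement of m hyperplanes of rank m - 1, whose module of
   derivations needs more than n+1 generators.  If Gamma_X is chordal, A_X is
   obtained from A_{W_X} by adding simplicial vertices one at a time (Dirac), and
   interpolation along the clique of neighbours preserves freeness. *)

Require Import Defs.
From HB Require Import structures.
From mathcomp Require Import all_boot all_order all_algebra.
From mathcomp Require Import mpoly.
From mathcomp Require Import ring.
From Stdlib Require Import Classical ClassicalEpsilon.

Set Implicit Arguments.
Unset Strict Implicit.
Unset Printing Implicit Defensive.

Import GRing.Theory.
Local Open Scope ring_scope.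

(** * Linear forms and divisibility *)

Section LinearForms.

Variables (k : closedFieldType) (n : nat).
Local Notation R := {mpoly k[n.+1]}.
Implicit Types (a b : 'rV[k]_n.+1) (f g : R) (theta : 'rV[R]_n.+1).

(** Freeness is traded for [locally_generated]: up to functions nonzero at a point, at most n+1
    logarithmic derivations generate. This asks for neither homogeneity nor independence, so it
    survives localization, translation and the addition of suitable hyperplanes; at the origin a
    graded Nakayama argument turns it back into a homogeneous basis. At a point of Proj some
    variable is a unit, so the Euler derivation does not vanish there and accounts for exactly one
    generator: a frame of rank r gives r+1 generators, and r <= n because more than n+1 vectors over
    the domain R are dependent. For a chordless cycle, n+2 explicit derivations are tested for a
    linear relation modulo the variables; the length at least 4 enters because a vertex and its next
    three successors are distinct. Conversely, the neighbours of an added vertex must form a clique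
    because Newton interpolation needs the difference of any two new forms to define a hyperplane
    already present. *)

Definition mdvd f g := exists h, g = h * f.

(** The value of the derivation [theta] on the linear form of [a]; see [der_apply_linear_form]. *)
Definition pairing theta a : R := \sum_i a 0 i *: theta 0 i.

Lemma mdvd0 f : mdvd f 0.
Proof. by exists 0; rewrite mul0r. Qed.

Lemma mdvd_refl f : mdvd f f.
Proof. by exists 1; rewrite mul1r. Qed.

Lemma mdvdD f g h : mdvd f g -> mdvd f h -> mdvd f (g + h).
Proof. by case=> u -> [v ->]; exists (u + v); rewrite mulrDl. Qed.

Lemma mdvd_mull f g h : mdvd f g -> mdvd f (h * g).
Proof. by case=> u ->; exists (h * u); rewrite mulrA. Qed.

Lemma mdvd_mulr f g h : mdvd f g -> mdvd f (g * h).
Proof. by move=> ?; rewrite mulrC; apply: mdvd_mull. Qed.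

Lemma mdvdN f g : mdvd f g -> mdvd f (- g).
Proof. by move=> fg; rewrite -mulN1r; apply: mdvd_mull. Qed.

Lemma mdvdB f g h : mdvd f g -> mdvd f h -> mdvd f (g - h).
Proof. by move=> fg fh; apply: mdvdD => //; apply: mdvdN. Qed.

Lemma mdvdZ f g c : mdvd f g -> mdvd f (c *: g).
Proof. by rewrite -mul_mpolyC; apply: mdvd_mull. Qed.

Lemma mdvdZl f g c : c != 0 -> mdvd f g -> mdvd (c *: f) g.
Proof.
move=> c0 [h ->]; exists (c^-1 *: h).
by rewrite -scalerAr -scalerAl scalerA divff ?scale1r.
Qed.

Lemma linear_formE a : linear_form a = pairing (euler k n) a.
Proof. by apply: eq_bigr => i _; rewrite mxE. Qed.

Lemma pairingDl theta eta a : pairing (theta + eta) a = pairing theta a + pairing eta a.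
Proof. by rewrite -big_split; apply: eq_bigr => i _; rewrite mxE scalerDr. Qed.

Lemma pairingZl f theta a : pairing (f *: theta) a = f * pairing theta a.
Proof. by rewrite mulr_sumr; apply: eq_bigr => i _; rewrite mxE scalerAr. Qed.

Lemma pairing_suml (I : finType) (P : pred I) (F : I -> 'rV[R]_n.+1) a :
  pairing (\sum_(i | P i) F i) a = \sum_(i | P i) pairing (F i) a.
Proof.
rewrite exchange_big; apply: eq_bigr => i _ /=.
by rewrite summxE scaler_sumr.
Qed.

Lemma pairing0l a : pairing 0 a = 0.
Proof. by apply: big1 => i _; rewrite mxE scaler0. Qed.

Lemma pairingDr theta a b : pairing theta (a + b) = pairing theta a + pairing theta b.
Proof. by rewrite -big_split; apply: eq_bigr => i _; rewrite mxE scalerDl. Qed.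

Lemma pairingZr theta c a : pairing theta (c *: a) = c *: pairing theta a.
Proof. by rewrite scaler_sumr; apply: eq_bigr => i _; rewrite mxE scalerA. Qed.

Lemma pairingNr theta a : pairing theta (- a) = - pairing theta a.
Proof. by rewrite -scaleN1r pairingZr scaleN1r. Qed.

Lemma pairingBr theta a b : pairing theta (a - b) = pairing theta a - pairing theta b.
Proof. by rewrite pairingDr pairingNr. Qed.

Lemma pairing_delta theta i : pairing theta (delta_mx 0 i) = theta 0 i.
Proof.
rewrite /pairing (bigD1 i) //= mxE !eqxx scale1r big1 ?addr0 // => j ji.
by rewrite mxE eqxx (negPf ji) scale0r.
Qed.

Lemma pairing_deltal f i a : pairing (f *: delta_mx 0 i) a = a 0 i *: f.
Proof.
rewrite pairingZl /pairing (bigD1 i) //= mxE !eqxx big1 ?addr0 => [|j ji].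
  by rewrite -scalerAr mulr1.
by rewrite mxE eqxx (negPf ji) scaler0.
Qed.

Lemma mcoeff_linear_form a i : (linear_form a)@_U_(i) = a 0 i.
Proof.
rewrite /linear_form raddf_sum (bigD1 i) //= mcoeffZ mcoeffX eqxx mulr1.
rewrite big1 ?addr0 // => j ji.
by rewrite mcoeffZ mcoeffX eq_mnm1 (negPf ji) mulr0.
Qed.

Lemma linear_form0 : linear_form 0 = 0 :> R.
Proof. by rewrite linear_formE -(scale0r 0) pairingZr scale0r. Qed.

Lemma linear_form_eq0 a : (linear_form a == 0) = (a == 0).
Proof.
apply/eqP/eqP => [a0|->]; last exact: linear_form0.
by apply/rowP => i; rewrite -mcoeff_linear_form a0 mcoeff0 mxE.
Qed.

Lemma linear_form_delta i : linear_form (delta_mx 0 i : 'rV[k]_n.+1) = 'X_i.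
Proof. by rewrite linear_formE pairing_delta mxE. Qed.

Lemma meval_linear_form (v : 'I_n.+1 -> k) a : (linear_form a).@[v] = \sum_i a 0 i * v i.
Proof. by rewrite raddf_sum; apply: eq_bigr => i _; rewrite /= mevalZ mevalXU. Qed.

Lemma linear_form_homog a : linear_form a \is 1.-homog.
Proof.
apply: rpred_sum => i _; apply: dhomogZ.
by rewrite dhomogX /= mdeg1.
Qed.

Lemma mderiv_linear_form a i : (linear_form a)^`M(i) = (a 0 i)%:MP.
Proof.
rewrite /linear_form raddf_sum (bigD1 i) //= mderivZ mderivX mnm1E eqxx.
rewrite big1 => [|j ji].
  have -> : (U_(i) - U_(i) = 0 :> 'X_{1..n.+1})%MM by apply/mnmP => j; rewrite mnmBE mnm0E subnn.
  by rewrite mpolyX0 scale1r addr0 -mul_mpolyC mulr1.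
by rewrite mderivZ mderivX mnm1E (negPf ji) scale0r scaler0.
Qed.

Lemma der_apply_linear_form theta a : der_apply theta (linear_form a) = pairing theta a.
Proof.
by apply: eq_bigr => i _; rewrite mderiv_linear_form mulrC mul_mpolyC.
Qed.

(* Elimination of the variable [i] by [linear_form a = 0]: its kernel is the
   ideal of [linear_form a], so a hyperplane has a prime ideal. *)
Definition kill a i (f : R) : R :=
  f \mPo [tuple 'X_j - (if j == i then (a 0 i)^-1 *: linear_form a else 0) | j < n.+1].

HB.instance Definition _ a i := GRing.RMorphism.copy (kill a i)
  (comp_mpoly [tuple 'X_j - (if j == i then (a 0 i)^-1 *: linear_form a else 0) | j < n.+1]).

Lemma killZ a i c f : kill a i (c *: f) = c *: kill a i f.
Proof. exact: comp_mpolyZ. Qed.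

Lemma killX a i j :
  kill a i 'X_j = 'X_j - (if j == i then (a 0 i)^-1 *: linear_form a else 0).
Proof.
by rewrite /kill comp_mpolyXU -tnth_nth tnth_mktuple.
Qed.

Lemma kill_linear_form a i b :
  kill a i (linear_form b) = linear_form b - (b 0 i / a 0 i) *: linear_form a.
Proof.
rewrite {1}/linear_form raddf_sum /=.
under eq_bigr do rewrite killZ killX scalerBr.
rewrite big_split /= sumrN; congr (_ - _).
rewrite (bigD1 i) //= eqxx scalerA big1 ?addr0 // => j ji.
by rewrite (negPf ji) scaler0.
Qed.

Lemma kill_self a i : a 0 i != 0 -> kill a i (linear_form a) = 0.
Proof. by move=> ai; rewrite kill_linear_form divff // scale1r subrr. Qed.

(** A variable and its image differ by a multiple of the form, and congruences multiply. *)
Lemma kill_congr a i f : mdvd (linear_form a) (f - kill a i f).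
Proof.
elim/mpolyind: f => [|c m f _ _ IH]; first by rewrite raddf0 subrr; exact: mdvd0.
rewrite raddfD /= opprD addrACA; apply: mdvdD => //.
rewrite killZ -scalerBr; apply: mdvdZ.
rewrite mpolyXE_id rmorph_prod /=.
elim/big_rec2: _ => [|j p q _ IHj]; first by rewrite subrr; exact: mdvd0.
have -> : 'X_j ^+ m j * q - kill a i ('X_j ^+ m j) * p =
  ('X_j ^+ m j - kill a i ('X_j ^+ m j)) * q + kill a i ('X_j ^+ m j) * (q - p).
  by ring.
apply: mdvdD; last exact: mdvd_mull.
apply: mdvd_mulr; rewrite rmorphXn /= subrXX; apply: mdvd_mulr.
rewrite killX opprB addrC addrNK.
by case: ifP => _; [exact/mdvdZ/mdvd_refl|exact: mdvd0].
Qed.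

Lemma mdvd_linear_formP a i f :
  a 0 i != 0 -> mdvd (linear_form a) f <-> kill a i f = 0.
Proof.
move=> ai; split=> [[g ->]|f0].
  by rewrite rmorphM /= kill_self // mulr0.
by have := kill_congr a i f; rewrite f0 subr0.
Qed.

Lemma row_neq0P a : a != 0 -> exists i, a 0 i != 0.
Proof.
move=> a0; apply/existsP; apply: contraNT a0; rewrite negb_exists => /forallP h.
by apply/eqP/rowP => i; rewrite mxE; apply/eqP; move: (h i); rewrite negbK.
Qed.

Lemma linear_form_prime a f g : a != 0 -> mdvd (linear_form a) (f * g) ->
  mdvd (linear_form a) f \/ mdvd (linear_form a) g.
Proof.
case/row_neq0P => i ai; rewrite !(mdvd_linear_formP _ ai) rmorphM /=.
by move/eqP; rewrite mulf_eq0 => /orP[]/eqP; [left|right].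
Qed.

Lemma linear_form_mdvd a b : a != 0 -> mdvd (linear_form a) (linear_form b) ->
  exists c, b = c *: a.
Proof.
case/row_neq0P => i ai; rewrite (mdvd_linear_formP _ ai) kill_linear_form => /eqP.
rewrite !linear_formE -pairingZr -pairingBr -linear_formE linear_form_eq0 subr_eq0.
by move/eqP; exists (b 0 i / a 0 i).
Qed.

Lemma mdvd_linear_form_scale a c f :
  c != 0 -> mdvd (linear_form (c *: a)) f <-> mdvd (linear_form a) f.
Proof.
move=> c0; rewrite linear_formE pairingZr -linear_formE; split; last exact: mdvdZl.
by move/(mdvdZl (invr_neq0 c0)); rewrite scalerA mulVf // scale1r.
Qed.

Lemma linear_form_mdvd1 a : a != 0 -> ~ mdvd (linear_form a) 1.
Proof.
case/row_neq0P => i ai; rewrite (mdvd_linear_formP _ ai) rmorph1.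
by move/eqP; rewrite oner_eq0.
Qed.

Lemma linear_form_prime_prod a (bs : seq 'rV[k]_n.+1) : a != 0 ->
  mdvd (linear_form a) (\prod_(b <- bs) linear_form b) ->
  exists2 b, b \in bs & mdvd (linear_form a) (linear_form b).
Proof.
move=> a0; elim: bs => [|b bs IH]; first by rewrite big_nil => /(linear_form_mdvd1 a0).
rewrite big_cons => /(linear_form_prime a0)[ab|/IH[c cbs ac]].
  by exists b; rewrite ?mem_head.
by exists c; rewrite // inE cbs orbT.
Qed.

(** The forms are primes, none dividing another, so each new one must divide the cofactor of the
    product already split off. *)
Lemma mdvd_prod (bs : seq 'rV[k]_n.+1) f : uniq bs ->
  (forall b, b \in bs -> b != 0) ->
  {in bs &, forall a b, mdvd (linear_form a) (linear_form b) -> a = b} ->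
  (forall b, b \in bs -> mdvd (linear_form b) f) ->
  mdvd (\prod_(b <- bs) linear_form b) f.
Proof.
elim: bs => [|b bs IH] /=; first by exists f; rewrite big_nil mulr1.
case/andP => bbs ubs bs0 dist dvd; rewrite big_cons.
have [g fE] : mdvd (\prod_(c <- bs) linear_form c) f.
  apply: IH => //.
  - by move=> c cbs; apply: bs0; rewrite inE cbs orbT.
  - by move=> c d cbs dbs; apply: dist; rewrite inE ?cbs ?dbs orbT.
  - by move=> c cbs; apply: dvd; rewrite inE cbs orbT.
have b0 := bs0 _ (mem_head _ _).
have : mdvd (linear_form b) (g * \prod_(c <- bs) linear_form c).
  by rewrite -fE; apply: dvd; exact: mem_head.
case/(linear_form_prime b0) => [[h gE]|/(linear_form_prime_prod b0)[c cbs bc]].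
  by exists h; rewrite fE gE mulrA.
have bE : b = c by apply: dist; rewrite ?mem_head // inE cbs orbT.
by rewrite bE cbs in bbs.
Qed.

End LinearForms.

(** * Homogeneous components and constant terms *)

Section Grading.

Variables (k : closedFieldType) (n : nat).
Local Notation R := {mpoly k[n.+1]}.
Implicit Types (a b : 'rV[k]_n.+1) (f g : R) (theta : 'rV[R]_n.+1).

(* The coefficient of degree [d - e], which is [0] when [d < e]. *)
Definition gshift d e f : R := if (e <= d)%N then pihomog mdeg (d - e) f else 0.

Lemma pihomogM d e f g : g \is e.-homog -> pihomog mdeg d (f * g) = gshift d e f * g.
Proof.
move=> ge; set K := (maxn (msize f) d.+1).
(* [K] exceeds d so that the component of degree d - e is a term of the sum even when it is zero. *)
rewrite {1}(@pihomog_partitionE _ _ mdeg K f) ?leq_maxl // mulr_suml linear_sum /=.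
have homM (j : 'I_K) : pihomog mdeg j f * g \is (j + e).-homog.
  by apply: dhomogM => //; exact: pihomogP.
rewrite /gshift; case: leqP => [le_ed|lt_de]; last first.
  rewrite mul0r big1 // => j _; apply: (pihomog_ne0 _ (homM j)).
  by rewrite neq_ltn (leq_trans lt_de) ?leq_addl ?orbT.
have dK : (d - e < K)%N by rewrite leq_max ltnS leq_subr orbT.
rewrite (bigD1 (Ordinal dK)) //= pihomog_dE; last by rewrite -{2}(subnK le_ed); exact: homM (Ordinal dK).
rewrite big1 ?addr0 // => j jd; apply: (pihomog_ne0 _ (homM j)).
apply: contraNneq jd => jE; apply/eqP/val_inj => /=.
by rewrite -jE addnK.
Qed.

Definition ev0 f : k := f.@[fun => 0].

HB.instance Definition _ := GRing.RMorphism.copy ev0 (meval (fun => 0)).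

Lemma ev0C c : ev0 c%:MP = c.
Proof. exact: mevalC. Qed.

Lemma ev0M f g : ev0 (f * g) = ev0 f * ev0 g.
Proof. exact: mevalM. Qed.

Lemma ev0D f g : ev0 (f + g) = ev0 f + ev0 g.
Proof. exact: mevalD. Qed.

Lemma ev0B f g : ev0 (f - g) = ev0 f - ev0 g.
Proof. exact: mevalB. Qed.

Lemma ev0_sum (I : finType) (P : pred I) (F : I -> R) :
  ev0 (\sum_(i | P i) F i) = \sum_(i | P i) ev0 (F i).
Proof. exact: raddf_sum. Qed.

Lemma ev0Z c f : ev0 (c *: f) = c * ev0 f.
Proof. exact: mevalZ. Qed.

Lemma pihomog0_ev0 f : pihomog mdeg 0 f = (ev0 f)%:MP.
Proof.
elim/mpolyind: f => [|c m f _ _ IH]; first by rewrite raddf0 raddf0 mpolyC0.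
rewrite !raddfD /= IH; congr (_ + _).
rewrite linearZ ev0Z /= pihomogX /ev0 mevalX mdeg_eq0.
case: eqVneq => [->|m0].
  rewrite big1 ?mulr1 => [|i _]; first by rewrite mpolyX0 -mul_mpolyC mulr1.
  by rewrite mnm0E.
have [i im] : exists i, m i != 0%N.
  apply/existsP; apply: contraNT m0; rewrite negb_exists => /forallP h.
  by apply/eqP/mnmP => i; rewrite mnm0E; apply/eqP; rewrite -[_ == _]negbK.
by rewrite (bigD1 i) //= expr0n (negPf im) mul0r mulr0 mpolyC0 scaler0.
Qed.

Lemma ev0_homog d f : (0 < d)%N -> f \is d.-homog -> ev0 f = 0.
Proof.
move=> d0 fd; apply/eqP; rewrite -(mpolyC_eq0 n.+1) -pihomog0_ev0.
by rewrite (pihomog_ne0 _ fd) // -lt0n.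
Qed.

Lemma ev0_linear_form a : ev0 (linear_form a) = 0.
Proof. exact: ev0_homog (linear_form_homog a). Qed.

Lemma gshift_ev0 d f : gshift d d f = (ev0 f)%:MP.
Proof. by rewrite /gshift leqnn subnn pihomog0_ev0. Qed.

Definition row_homog d theta := forall i, theta 0 i \is d.-homog.

Definition row_part d theta := map_mx (pihomog mdeg d) theta.

Lemma row_part_homog d theta : row_homog d (row_part d theta).
Proof. by move=> i; rewrite mxE; exact: pihomogP. Qed.

Lemma row_part_id d theta : row_homog d theta -> row_part d theta = theta.
Proof. by move=> h; apply/rowP => i; rewrite mxE pihomog_dE. Qed.

Lemma row_partD d theta eta : row_part d (theta + eta) = row_part d theta + row_part d eta.
Proof. by apply/rowP => i; rewrite !mxE raddfD. Qed.

Lemma row_partB d theta eta : row_part d (theta - eta) = row_part d theta - row_part d eta.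
Proof. by apply/rowP => i; rewrite !mxE raddfB. Qed.

Lemma row_part_sum d (I : finType) (F : I -> 'rV[R]_n.+1) :
  row_part d (\sum_i F i) = \sum_i row_part d (F i).
Proof.
apply/rowP => j; rewrite mxE !summxE raddf_sum; apply: eq_bigr => i _.
by rewrite mxE.
Qed.

Lemma row_part0 d : row_part d 0 = 0.
Proof. by apply/rowP => i; rewrite !mxE raddf0. Qed.

Lemma row_part_scale d e f theta : row_homog e theta ->
  row_part d (f *: theta) = gshift d e f *: theta.
Proof. by move=> h; apply/rowP => i; rewrite !mxE (pihomogM _ _ (h i)). Qed.

Lemma row_homog_scale d e f theta : f \is d.-homog -> row_homog e theta ->
  row_homog (d + e) (f *: theta).
Proof. by move=> fd h i; rewrite mxE; apply: dhomogM. Qed.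

Lemma row_part_partition K theta : (forall i, msize (theta 0%R i) <= K)%N ->
  theta = \sum_(d < K) row_part d theta.
Proof.
move=> thK; apply/rowP => i; rewrite summxE.
rewrite {1}(@pihomog_partitionE _ _ mdeg K (theta 0 i)) //.
by apply: eq_bigr => d _; rewrite mxE.
Qed.

Lemma pairing_part d theta a : pairing (row_part d theta) a = pihomog mdeg d (pairing theta a).
Proof.
rewrite /pairing linear_sum; apply: eq_bigr => i _.
by rewrite mxE linearZ.
Qed.

Lemma euler_homog : row_homog 1 (euler k n).
Proof. by move=> i; rewrite mxE dhomogX /= mdeg1. Qed.

End Grading.

(** * Logarithmic derivations *)

Section LogarithmicDerivations.

Variables (k : closedFieldType) (n : nat).
Local Notation R := {mpoly k[n.+1]}.
Implicit Types (A : seq 'rV[k]_n.+1) (a b : 'rV[k]_n.+1) (f g : R) (theta : 'rV[R]_n.+1).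

Definition log_der A theta :=
  forall a, a \in A -> mdvd (linear_form a) (pairing theta a).

Lemma log_derD A theta eta : log_der A theta -> log_der A eta -> log_der A (theta + eta).
Proof. by move=> h1 h2 a aA; rewrite pairingDl; apply: mdvdD; [exact: h1|exact: h2]. Qed.

Lemma log_der0 A : log_der A 0.
Proof. by move=> a _; rewrite pairing0l; exact: mdvd0. Qed.

Lemma log_derZ A f theta : log_der A theta -> log_der A (f *: theta).
Proof. by move=> h a aA; rewrite pairingZl; apply: mdvd_mull; exact: h. Qed.

Lemma log_derB A theta eta : log_der A theta -> log_der A eta -> log_der A (theta - eta).
Proof. by move=> h1 h2; rewrite -scaleN1r; apply: log_derD => //; apply: log_derZ. Qed.

Lemma log_der_sum A (I : finType) (P : pred I) (F : I -> 'rV[R]_n.+1) :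
  (forall i, P i -> log_der A (F i)) -> log_der A (\sum_(i | P i) F i).
Proof. by move=> h; elim/big_ind: _ => //; [exact: log_der0|exact: log_derD]. Qed.

Lemma log_der_sub A A' theta : {subset A' <= A} -> log_der A theta -> log_der A' theta.
Proof. by move=> sub h a /sub; exact: h. Qed.

Lemma log_der_part A d theta : log_der A theta -> log_der A (row_part d theta).
Proof.
move=> h a /h[g gE]; rewrite pairing_part gE (pihomogM _ _ (linear_form_homog a)).
by apply: mdvd_mull; exact: mdvd_refl.
Qed.

Lemma log_der_euler A : log_der A (euler k n).
Proof. by move=> a _; rewrite -linear_formE; exact: mdvd_refl. Qed.

(** These multiples show that Der(-log A) has full rank; they also serve to pass from a
    subarrangement back to the whole arrangement. *)
Lemma log_der_defining_poly A theta : log_der A (defining_poly A *: theta).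
Proof.
move=> a aA; rewrite pairingZl; apply: mdvd_mulr.
by rewrite /defining_poly (big_rem a) //=; apply: mdvd_mulr; exact: mdvd_refl.
Qed.

Lemma defining_poly_neq0 A : (forall a, a \in A -> a != 0) -> defining_poly A != 0.
Proof.
move=> A0; rewrite /defining_poly prodf_seq_neq0; apply/allP => a aA.
by rewrite /= linear_form_eq0 A0.
Qed.

Lemma mem_hyperplane a x : (x \in hyperplane a) = (\sum_i x 0 i * a 0 i == 0).
Proof.
rewrite memv_ker lfunE; apply: (@etrans _ _ (x *m a^T == 0 :> 'rV[k]_1)) => //.
have -> : (x *m a^T == 0) = ((x *m a^T) 0 0 == 0).
  apply/eqP/eqP => [->|h]; first by rewrite mxE.
  by apply/rowP => i; rewrite ord1 h mxE.
by rewrite mxE; under eq_bigr do rewrite mxE.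
Qed.

Lemma hyperplane_scale a c : c != 0 -> hyperplane (c *: a) = hyperplane a.
Proof.
move=> c0; apply/vspaceP => x; rewrite !mem_hyperplane.
under eq_bigr do rewrite mxE mulrCA.
by rewrite -mulr_sumr mulf_eq0 (negPf c0).
Qed.

Lemma arrangement_neq0 A a : arrangement A -> a \in A -> a != 0.
Proof. by case/andP => /allP h _ /h. Qed.

Lemma arrangement_uniq A : arrangement A -> uniq A.
Proof. by case/andP => _; exact: map_uniq. Qed.

Lemma arrangement_inj A a b : arrangement A -> a \in A -> b \in A ->
  hyperplane a = hyperplane b -> a = b.
Proof.
case/andP => _; elim: A => //= c A IH /andP[cA uA].
rewrite !inE => /orP[/eqP->|aA] /orP[/eqP->|bA] // ab; last exact: IH.
  by rewrite ab map_f in cA.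
by rewrite -ab map_f in cA.
Qed.

Lemma arrangement_scale A a b c : arrangement A -> a \in A -> b \in A ->
  b = c *: a -> a = b.
Proof.
move=> arrA aA bA bE; apply: (arrangement_inj arrA) => //.
have [c0|c0] := eqVneq c 0; last by rewrite bE hyperplane_scale.
by have := arrangement_neq0 arrA bA; rewrite bE c0 scale0r eqxx.
Qed.

Lemma arrangement_mdvd A a b : arrangement A -> a \in A -> b \in A ->
  mdvd (linear_form a) (linear_form b) -> a = b.
Proof.
move=> arrA aA bA /(linear_form_mdvd (arrangement_neq0 arrA aA))[c].
exact: (arrangement_scale arrA).
Qed.

Lemma arrangement_cons A a : arrangement (a :: A) -> arrangement A.
Proof. by case/andP => /= /andP[_ h] /andP[_ u]; apply/andP. Qed.

Lemma arrangement_filter A (P : pred 'rV[k]_n.+1) :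
  arrangement A -> arrangement [seq a <- A | P a].
Proof.
elim: A => //= a A IH arrA; have IHA := IH (arrangement_cons arrA).
case: ifP => // _; rewrite /arrangement /=.
case/andP: IHA => -> ->; rewrite (arrangement_neq0 arrA) ?mem_head //= !andbT.
case/andP: arrA => _ /= /andP[+ _]; apply: contraNN => /mapP[b].
by rewrite mem_filter => /andP[_ bA] ->; apply: map_f.
Qed.

Lemma der_applyM theta f g :
  der_apply theta (f * g) = der_apply theta f * g + f * der_apply theta g.
Proof.
rewrite /der_apply mulr_suml mulr_sumr -big_split; apply: eq_bigr => i _ /=.
by rewrite mderivM; ring.
Qed.

Lemma der_apply1 theta : der_apply theta 1 = 0.
Proof. by apply: big1 => i _; rewrite -mpolyC1 mderivC mulr0. Qed.

(** By the Leibniz rule the first form divides its own derivative times the product of the others.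
    It is prime and, the hyperplanes being distinct, divides none of the others, so it divides its
    derivative. *)
Lemma Der_logP A theta : arrangement A -> Der_log A theta <-> log_der A theta.
Proof.
rewrite /Der_log /defining_poly; elim: A => [|a A IH] arrA.
  by split=> // _; exists 0; rewrite big_nil der_apply1 mul0r.
have {IH}IH := IH (arrangement_cons arrA).
have a0 := arrangement_neq0 arrA (mem_head _ _).
rewrite big_cons der_applyM der_apply_linear_form; set f := \prod_(b <- A) _ in IH *.
split=> [[g gE]|dA].
  have [|[h hE]|/(linear_form_prime_prod a0)[b bA ab]] :=
      @linear_form_prime _ _ a (pairing theta a) f a0.
  - exists (g * f - der_apply theta f); rewrite mulrBl.
    have -> : g * f * linear_form a = g * (linear_form a * f) by ring.
    by rewrite -gE; ring.
  - move=> b; rewrite inE => /orP[/eqP->|]; first by exists h.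
    move: b; apply/IH; exists (g - h).
    apply: (@mulfI _ (linear_form a)); first by rewrite linear_form_eq0.
    have -> : linear_form a * ((g - h) * f) = g * (linear_form a * f) - h * linear_form a * f.
      by ring.
    by rewrite -gE hE; ring.
  - have ab' : a = b by apply: (arrangement_mdvd arrA) => //; rewrite ?mem_head // inE bA orbT.
    have := arrangement_uniq arrA; by rewrite /= ab' bA.
have [h hE] := dA a (mem_head _ _).
have [g gE] : exists g, der_apply theta f = g * f.
  by apply/IH => b bA; apply: dA; rewrite inE bA orbT.
by exists (h + g); rewrite hE gE; ring.
Qed.

End LogarithmicDerivations.

Lemma choice_fun (T U : Type) (P : T -> U -> Prop) :
  (forall x, exists y, P x y) -> exists f, forall x, P x (f x).
Proof.
move=> h; exists (fun x => proj1_sig (constructive_indefinite_description _ (h x))) => x.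
exact: proj2_sig.
Qed.

Section Span.

Variables (k : closedFieldType) (n : nat).
Local Notation R := {mpoly k[n.+1]}.
Implicit Types (I J : finType) (f : R) (theta : 'rV[R]_n.+1).

Definition span I (S : I -> 'rV[R]_n.+1) theta := exists c : I -> R, theta = \sum_i c i *: S i.

Lemma span0 I (S : I -> 'rV[R]_n.+1) : span S 0.
Proof. by exists (fun=> 0); rewrite big1 // => i _; rewrite scale0r. Qed.

Lemma spanD I (S : I -> 'rV[R]_n.+1) theta eta : span S theta -> span S eta -> span S (theta + eta).
Proof.
case=> c -> [d ->]; exists (fun i => c i + d i).
by rewrite -big_split; apply: eq_bigr => i _; rewrite scalerDl.
Qed.

Lemma spanZ I (S : I -> 'rV[R]_n.+1) f theta : span S theta -> span S (f *: theta).
Proof.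
case=> c ->; exists (fun i => f * c i).
by rewrite scaler_sumr; apply: eq_bigr => i _; rewrite scalerA.
Qed.

Lemma span_sum I (S : I -> 'rV[R]_n.+1) J (P : pred J) (F : J -> 'rV[R]_n.+1) :
  (forall j, P j -> span S (F j)) -> span S (\sum_(j | P j) F j).
Proof. by move=> h; elim/big_ind: _ => //; [exact: span0|exact: spanD]. Qed.

Lemma span_mem I (S : I -> 'rV[R]_n.+1) i : span S (S i).
Proof.
exists (fun j => (j == i)%:R); rewrite (bigD1 i) //= eqxx scale1r big1 ?addr0 // => j /negPf->.
by rewrite scale0r.
Qed.

Lemma span_trans I J (S : I -> 'rV[R]_n.+1) (T : J -> 'rV[R]_n.+1) theta :
  (forall i, span T (S i)) -> span S theta -> span T theta.
Proof. by move=> h [c ->]; apply: span_sum => i _; apply: spanZ. Qed.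

End Span.

(** Padding with zero columns gives a singular square matrix, and over a domain such a matrix has a
    nonzero left kernel vector. *)
Lemma kernel_vector (D : idomainType) m p (M : 'M[D]_(m, p)) : (p < m)%N ->
  exists2 v : 'rV[D]_m, v != 0 & v *m M = 0.
Proof.
move=> pm; pose A := \matrix_(i < m, j < m) oapp (M i) 0 (insub (val j) : option 'I_p).
have /det0P[v v0 vA] : \det A == 0.
  rewrite -det_tr; apply/det0P; exists (delta_mx 0 (Ordinal pm)).
    by apply/eqP => /rowP/(_ (Ordinal pm))/eqP; rewrite !mxE !eqxx oner_eq0.
  apply/rowP => j; rewrite -rowE !mxE insubF //=.
  by rewrite ltnn.
exists v => //; apply/rowP => j; rewrite !mxE.
have jm : (j < m)%N by exact: ltn_trans (ltn_ord j) pm.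
have := congr1 (fun w : 'rV_m => w 0 (Ordinal jm)) vA; rewrite !mxE => vAj.
rewrite -[RHS]vAj; apply: eq_bigr => i _; rewrite mxE insubT //= => ltjp.
by congr (_ * M _ _); apply: val_inj.
Qed.

(** * Homogeneous generators *)

Section HomogeneousGenerators.

Variables (k : closedFieldType) (n : nat).
Local Notation R := {mpoly k[n.+1]}.
Implicit Types (A : seq 'rV[k]_n.+1) (f g : R) (theta : 'rV[R]_n.+1).

(** Generation over the local ring of the affine point [p], with a denominator depending on [theta].
    Independence is not asked; at the origin it is recovered from [generators_independent]. *)
Definition locally_generated A (p : 'I_n.+1 -> k) :=
  exists m, exists B : 'I_m -> 'rV[R]_n.+1,
  [/\ (m <= n.+1)%N, forall i, log_der A (B i) &
      forall theta, log_der A theta ->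
        exists2 g : R, g.@[p] != 0 & span B (g *: theta)].

Definition homog_generated A m :=
  exists (S : 'I_m -> 'rV[R]_n.+1) (d : 'I_m -> nat),
  [/\ forall i, log_der A (S i), forall i, row_homog (d i) (S i) &
      forall theta, log_der A theta -> span S theta].

Lemma homog_generated_pad A m : homog_generated A m -> homog_generated A m.+1.
Proof.
case=> S [d [SA Sd Sgen]].
exists (fun i => if unlift ord0 i is Some j then S j else 0).
exists (fun i => if unlift ord0 i is Some j then d j else 0%N); split.
- by move=> i; case: unliftP => [j|] _ //; exact: log_der0.
- by move=> i; case: unliftP => [j|] _ // l; rewrite mxE; exact: rpred0.
move=> theta /Sgen; apply: span_trans => i.
set T := (fun _ => _); have -> : S i = T (lift ord0 i) by rewrite /T liftK.
exact: span_mem.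
Qed.

Lemma locally_generated_ev0 A : locally_generated A (fun=> 0) ->
  exists m, exists B : 'I_m -> 'rV[R]_n.+1,
  [/\ (m <= n.+1)%N, forall i, log_der A (B i) &
      forall theta, log_der A theta -> exists2 g : R, ev0 g = 1 & span B (g *: theta)].
Proof.
case=> m [B [mn BA Bgen]]; exists m, B; split=> // theta /Bgen[g g0 gB].
exists ((ev0 g)^-1 *: g); first by rewrite ev0Z mulVf.
by rewrite -mul_mpolyC -scalerA; apply: spanZ.
Qed.

(* Comparing components of degree [d] in [g theta = sum_i c_i B_i], where
   [g] has constant term 1, writes a homogeneous [theta] of degree [d] in terms
   of the homogeneous components of the [B_i]. *)
Lemma homog_generated_exists A : locally_generated A (fun=> 0) ->
  exists m, homog_generated A m.
Proof.
case/locally_generated_ev0 => m [B [_ BA Bgen]].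
pose K := \max_i \max_j msize (B i 0%R j).
have BK i j : (msize (B i 0%R j) <= K)%N.
  by rewrite (leq_trans _ (leq_bigmax i)) // (leq_bigmax j).
pose S (x : 'I_m * 'I_K) := row_part x.2 (B x.1).
have Sgen theta : log_der A theta -> span S theta.
  move=> thA; rewrite (@row_part_partition _ _ (\max_i msize (theta 0%R i)) theta); last first.
    by move=> i; exact: (leq_bigmax i).
  apply: span_sum => e _; set eta := row_part e theta.
  have etaA : log_der A eta by exact: log_der_part.
  have [g g1 [c gE]] := Bgen _ etaA.
  have <- : row_part e (g *: eta) = eta.
    by rewrite (row_part_scale _ _ (row_part_homog _ _)) gshift_ev0 g1 scale1r.
  rewrite gE row_part_sum; apply: span_sum => i _.
  rewrite (row_part_partition (BK i)) scaler_sumr row_part_sum.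
  apply: span_sum => d _; rewrite (row_part_scale _ _ (row_part_homog _ _)).
  exact/spanZ/(span_mem S (i, d)).
exists #|{: 'I_m * 'I_K}|, (fun i => S (enum_val i)), (fun i => nat_of_ord (enum_val i).2); split.
- by move=> i; apply: log_der_part; exact: BA.
- by move=> i; exact: row_part_homog.
move=> theta /Sgen; apply: span_trans => x.
rewrite -[x]enum_rankK; exact: (span_mem (fun i => S (enum_val i))).
Qed.

(* More than [n.+1] homogeneous generators are redundant: they are dependent
   modulo the variables, and a homogeneous component of such a dependence
   expresses one of them through the others. *)
Lemma homog_generated_drop A m : locally_generated A (fun=> 0) -> (n.+1 <= m)%N ->
  homog_generated A m.+1 -> homog_generated A m.
Proof.
case/locally_generated_ev0 => m0 [B [m0n BA Bgen]] nm [S [d [SA Sd Sgen]]].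
have gex i : exists h, ev0 h = 1 /\ span B (h *: S i).
  by have [h h1 hB] := Bgen _ (SA i); exists h.
have [g gP] := choice_fun gex.
have [C CE] := choice_fun (fun i => proj2 (gP i)).
have [D DE] := choice_fun (fun j => Sgen _ (BA j)).
(* The S_i outnumber the local generators B_j, so the constant terms of their coordinates are
   dependent. *)
have [v v0 vC] := @kernel_vector _ _ _ (\matrix_(i < m.+1, j < m0) ev0 (C i j))
  (leq_trans m0n nm : (m0 < m.+1)%N).
(* Expanding the B_j back in the S_l yields this relation; the subtracted part has no constant term
   by the choice of v. *)
pose rho l := (v 0 l)%:MP * g l - \sum_j (\sum_i (v 0 i)%:MP * C i j) * D j l.
have rhoS : \sum_l rho l *: S l = 0.
  under eq_bigr do rewrite scalerBl scaler_suml -scalerA CE scaler_sumr.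
  rewrite sumrB; apply/eqP; rewrite subr_eq0; apply/eqP.
  rewrite exchange_big [RHS]exchange_big; apply: eq_bigr => j _ /=.
  under [RHS]eq_bigr do rewrite -scalerA.
  rewrite -scaler_sumr -DE scaler_suml.
  by apply: eq_bigr => i _; rewrite scalerA.
have ev_rho l : ev0 (rho l) = v 0 l.
  rewrite ev0B ev0M ev0C (proj1 (gP l)) mulr1 ev0_sum.
  suff -> : \sum_j ev0 ((\sum_i (v 0 i)%:MP * C i j) * D j l) = 0 by rewrite subr0.
  apply: big1 => j _; rewrite ev0M ev0_sum; under eq_bigr do rewrite ev0M ev0C.
  have := congr1 (fun w : 'rV_m0 => w 0 j) vC; rewrite !mxE => vCj.
  have -> : \sum_i v 0 i * ev0 (C i j) = 0.
    by rewrite -[RHS]vCj; apply: eq_bigr => i _; rewrite mxE.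
  by rewrite mul0r.
have [l0 vl0] := row_neq0P v0.
have Sl0 : span (fun i => S (lift l0 i)) (S l0).
  have := congr1 (row_part (d l0)) rhoS; rewrite row_part0 row_part_sum.
  under eq_bigr do rewrite (row_part_scale _ _ (Sd _)).
  rewrite (bigD1_ord l0) //= gshift_ev0 ev_rho => /eqP; rewrite addr_eq0 => /eqP E.
  have -> : S l0 = ((v 0 l0)^-1)%:MP *: ((v 0 l0)%:MP *: S l0).
    by rewrite scalerA -mpolyCM mulVf // mpolyC1 scale1r.
  rewrite E; apply: spanZ; rewrite -scaleN1r; apply: spanZ.
  by apply: span_sum => i _; apply/spanZ/(span_mem (fun i => S (lift l0 i))).
exists (fun i => S (lift l0 i)), (fun i => d (lift l0 i)); split=> // theta.
move/Sgen; apply: span_trans => i; case: (unliftP l0 i) => [j|] -> //.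
exact: (span_mem (fun i => S (lift l0 i))).
Qed.

Lemma homog_basis_exists A : locally_generated A (fun=> 0) -> homog_generated A n.+1.
Proof.
move=> locA; have [m] := homog_generated_exists locA.
have [|/ltnW mn] := leqP n.+1 m; last first.
  by rewrite -(subnK mn); elim: (n.+1 - m)%N => // j IH /IH /homog_generated_pad.
move=> nm; rewrite -(subnKC nm); elim: (m - n.+1)%N => [|j IH]; first by rewrite addn0.
rewrite addnS => /(homog_generated_drop locA (leq_addr _ _)); exact: IH.
Qed.

Lemma span_matrix m (S : 'I_m -> 'rV[R]_n.+1) (c : 'I_m -> R) :
  \sum_i c i *: S i = (\row_i c i) *m (\matrix_i S i).
Proof.
apply/rowP => j; rewrite summxE mxE; apply: eq_bigr => i _; by rewrite !mxE.
Qed.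

(* A family of [n.+1] generators is automatically a basis, since the
   derivations [f_A d/dx_i] have determinant [f_A ^+ n.+1]. *)
Lemma generators_independent A (S : 'I_n.+1 -> 'rV[R]_n.+1) :
  (forall a, a \in A -> a != 0) -> (forall theta, log_der A theta -> span S theta) ->
  forall c : 'I_n.+1 -> R, \sum_i c i *: S i = 0 -> forall i, c i = 0.
Proof.
move=> A0 Sgen c c0 i; set f := defining_poly A.
have f0 : f != 0 by exact: defining_poly_neq0.
have [D DE] := choice_fun (fun j => Sgen _ (@log_der_defining_poly _ _ A (delta_mx 0 j))).
set M := \matrix_i S i.
have DM : (\matrix_(i, j) D i j) *m M = f%:M.
  apply/row_matrixP => j; rewrite row_mul.
  have -> : row j (\matrix_(i, j) D i j) = \row_l D j l by apply/rowP => l; rewrite !mxE.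
  rewrite -span_matrix -DE; apply/rowP => l; rewrite !mxE eqxx /=.
  by rewrite eq_sym mulr_natr.
have cM : (\row_i c i) *m M = 0 by rewrite -span_matrix.
have detM : \det M != 0.
  apply: contra_neq f0 => detM; have := congr1 determinant DM.
  by rewrite det_mulmx detM mulr0 det_scalar => /esym/eqP; rewrite expf_eq0 => /andP[_ /eqP].
have := congr1 (fun X => X *m \adj M) cM; rewrite -mulmxA mul_mx_adj mul0mx mul_mx_scalar.
move/rowP/(_ i); rewrite !mxE => /eqP; rewrite mulf_eq0 (negPf detM) /=.
by move/eqP.
Qed.

End HomogeneousGenerators.

(** * Localization at a point, translation and generic points *)

Section Localization.

Variables (k : closedFieldType) (n : nat).
Local Notation R := {mpoly k[n.+1]}.
Implicit Types (A : seq 'rV[k]_n.+1) (f g : R) (theta : 'rV[R]_n.+1) (p : 'I_n.+1 -> k).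

Lemma mpoly_rmorph_ext (S : pzRingType) (phi psi : {rmorphism R -> S}) :
  (forall c, phi c%:MP = psi c%:MP) -> (forall i, phi 'X_i = psi 'X_i) -> phi =1 psi.
Proof.
move=> eqC eqX; elim/mpolyind => [|c m f _ _ IH]; first by rewrite !rmorph0.
rewrite !rmorphD /= IH -mul_mpolyC !rmorphM /= eqC; congr (_ * _ + _).
rewrite mpolyXE_id !rmorph_prod; apply: eq_bigr => i _ /=.
by rewrite !rmorphXn /= eqX.
Qed.

Definition shift p f : R := f \mPo [tuple 'X_j + (p j)%:MP | j < n.+1].

HB.instance Definition _ p := GRing.RMorphism.copy (shift p)
  (comp_mpoly [tuple 'X_j + (p j)%:MP | j < n.+1]).

Lemma shiftC p c : shift p c%:MP = c%:MP.
Proof. exact: comp_mpolyC. Qed.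

Lemma shiftX p i : shift p 'X_i = 'X_i + (p i)%:MP.
Proof. by rewrite /shift comp_mpolyXU -tnth_nth tnth_mktuple. Qed.

Lemma shiftK p f : shift p (shift (fun i => - p i) f) = f.
Proof.
apply: (@mpoly_rmorph_ext _ (shift p \o shift (fun i => - p i)) idfun) => [c|i] /=.
  by rewrite !shiftC.
by rewrite shiftX rmorphD /= shiftX shiftC -addrA -mpolyCD subrr mpolyC0 addr0.
Qed.

Lemma shift_linear_form p a :
  shift p (linear_form a) = linear_form a + ((linear_form a).@[p])%:MP.
Proof.
rewrite meval_linear_form /linear_form raddf_sum /= [X in X%:MP]big_mkcond /=.
rewrite (raddf_sum (@mpolyC n.+1 k)) -big_split; apply: eq_bigr => i _ /=.
by rewrite -mul_mpolyC rmorphM /= shiftC shiftX mulrDr -mpolyCM.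
Qed.

Lemma ev0_shift p f : ev0 (shift p f) = f.@[p].
Proof.
rewrite /ev0 /shift comp_mpoly_meval; apply: meval_eq => i.
by rewrite tnth_mktuple mevalD mevalXU mevalC add0r.
Qed.

Definition through p A := [seq a <- A | (linear_form a).@[p] == 0].

Lemma log_der_shift p A theta : (forall a, a \in A -> (linear_form a).@[p] = 0) ->
  log_der A theta -> log_der A (map_mx (shift p) theta).
Proof.
move=> Ap h a aA; have [g gE] := h a aA; exists (shift p g).
have -> : pairing (map_mx (shift p) theta) a = shift p (pairing theta a).
  rewrite /pairing raddf_sum /=; apply: eq_bigr => i _.
  by rewrite mxE -!mul_mpolyC rmorphM /= shiftC.
by rewrite gE rmorphM /= shift_linear_form Ap // mpolyC0 addr0.
Qed.

(** Forms not vanishing at p are units there, and multiplying by their product makes a derivation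
    logarithmic along the hyperplanes through p logarithmic along all of A. *)
Lemma locally_generated_through A p : locally_generated A p ->
  locally_generated (through p A) p.
Proof.
case=> m [B [mn BA Bgen]]; exists m, B; split=> // [i|theta thA].
  by apply: log_der_sub (BA i) => a; rewrite mem_filter => /andP[].
pose f := defining_poly [seq a <- A | (linear_form a).@[p] != 0].
have fp : f.@[p] != 0.
  rewrite /f /defining_poly rmorph_prod prodf_seq_neq0; apply/allP => a /=.
  by rewrite mem_filter => /andP[].
have [|g gp gB] := Bgen (f *: theta).
  move=> a aA; have [ap|ap] := eqVneq (linear_form a).@[p] 0.
    by apply: log_derZ thA _ _; rewrite mem_filter ap eqxx.
  by apply: log_der_defining_poly; rewrite mem_filter ap.
by exists (g * f); rewrite ?mevalM ?mulf_neq0 // -scalerA.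
Qed.

(* Der(-log A) is invariant under translation by a point lying on every
   hyperplane. *)
Lemma locally_generated_shift A p : (forall a, a \in A -> (linear_form a).@[p] = 0) ->
  locally_generated A p -> locally_generated A (fun=> 0).
Proof.
move=> Ap [m [B [mn BA Bgen]]].
exists m, (fun i => map_mx (shift p) (B i)); split=> // [i|theta thA].
  exact: log_der_shift.
have Ap' a : a \in A -> (linear_form a).@[fun i => - p i] = 0.
  move=> /Ap; rewrite !meval_linear_form => E.
  by under eq_bigr do rewrite mulrN; rewrite sumrN E oppr0.
have [g gp [c gE]] := Bgen _ (log_der_shift Ap' thA).
exists (shift p g); first by rewrite -/(ev0 _) ev0_shift.
exists (fun i => shift p (c i)); apply/rowP => j.
have := congr1 (fun w : 'rV[R]_n.+1 => shift p (w 0 j)) gE.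
rewrite !mxE rmorphM /= shiftK => ->.
rewrite !summxE raddf_sum; apply: eq_bigr => i _ /=.
by rewrite !mxE rmorphM.
Qed.

(** Der(-log A) is graded, so freeness can be tested at the origin alone; coordinates are unique
    because n+1 generators of a module of rank n+1 are independent. *)
Lemma free_arrangementP A : arrangement A ->
  free_arrangement A <-> locally_generated A (fun=> 0).
Proof.
move=> arrA; split=> [[B [BA Bgen]]|/homog_basis_exists[S [d [SA _ Sgen]]]].
  exists n.+1, B; split=> // [i|theta thA]; first exact/Der_logP.
  exists 1; first by rewrite meval1 oner_neq0.
  have [c [cE _]] := Bgen theta (proj2 (Der_logP _ arrA) thA).
  by exists c; rewrite scale1r.
exists S; split=> [i|theta /(Der_logP _ arrA)/Sgen[c cE]]; first exact/Der_logP.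
exists [ffun i => c i]; split.
  by rewrite cE; apply: eq_bigr => i _; rewrite ffunE.
move=> c' c'E; apply/ffunP => i; rewrite ffunE; apply/eqP; rewrite -subr_eq0; apply/eqP.
have A0 a : a \in A -> a != 0 by exact: arrangement_neq0.
apply: (generators_independent A0 Sgen (c := fun i => c i - c' i)).
under eq_bigr do rewrite scalerBl.
by rewrite sumrB -cE -c'E subrr.
Qed.

Lemma locally_generated_log_der A A' p : (forall theta, log_der A theta <-> log_der A' theta) ->
  locally_generated A p -> locally_generated A' p.
Proof.
move=> AA' [m [B [mn BA Bgen]]]; exists m, B; split=> // [i|theta /AA'/Bgen//].
exact/AA'.
Qed.

Lemma locally_generated_nil p : locally_generated [::] p.
Proof.
exists n.+1, (fun i => delta_mx 0 i); split=> // theta _.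
exists 1; first by rewrite meval1 oner_neq0.
exists (fun i => theta 0 i); rewrite scale1r; exact: row_sum_delta.
Qed.

Hypothesis char0 : [pchar k] =i pred0.

Lemma not_mem_seq (s : seq k) : exists t, t \notin s.
Proof.
apply: NNPP => h; have inj : injective (fun j : nat => j%:R : k).
  have le i j : (i <= j)%N -> i%:R = j%:R :> k -> i = j.
    move=> ij /esym/eqP; rewrite -subr_eq0 -natrB // (proj1 (pcharf0P _) char0) subn_eq0 => ji.
    by apply/eqP; rewrite eqn_leq ij.
  move=> i j ij; have [/le|/ltnW/le] := leqP i j; first exact.
  by move/(_ (esym ij)).
have := @uniq_leq_size k [seq j%:R | j <- iota 0 (size s).+1] s.
rewrite map_inj_uniq // iota_uniq size_map size_iota ltnn => /(_ isT) absurd.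
suff /absurd : {subset [seq j%:R | j <- iota 0 (size s).+1] <= s} by [].
by move=> t _; apply: NNPP => ts; apply: h; exists t; apply/negP.
Qed.

(** Let p avoid the earlier hyperplanes and q the new one: on the line p + t q each hyperplane
    excludes at most one t, and k is infinite. A predicate [Y] also accommodates subspaces given by
    equations. *)
Lemma generic_point (Y : 'rV[k]_n.+1 -> Prop) (bs : seq 'rV[k]_n.+1) :
  (forall x y t, Y x -> Y y -> Y (x + t *: y)) -> (exists y, Y y) ->
  (forall b, b \in bs -> exists2 y, Y y & y \notin hyperplane b) ->
  exists2 p, Y p & forall b, b \in bs -> p \notin hyperplane b.
Proof.
move=> Ylin Y0; elim: bs => [_|b bs IH Yb]; first by case: Y0 => y; exists y.
have [|p Yp pbs] := IH; first by move=> c cbs; apply: Yb; rewrite inE cbs orbT.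
have [q Yq qb] := Yb _ (mem_head _ _).
pose dot (x c : 'rV[k]_n.+1) := \sum_i x 0 i * c 0 i.
(* If c vanishes at q the quotient is 0 by convention, which merely excludes t = 0. *)
have [t tP] := not_mem_seq [seq - (dot p c) / (dot q c) | c <- b :: bs].
exists (p + t *: q); first exact: Ylin.
have dotE c : dot (p + t *: q) c = dot p c + t * dot q c.
  rewrite /dot mulr_sumr -big_split; apply: eq_bigr => i _ /=.
  by rewrite !mxE mulrDl mulrA.
move=> c cbs; rewrite mem_hyperplane -/(dot _ _) dotE.
have [qc0|qc0] := eqVneq (dot q c) 0.
  rewrite qc0 mulr0 addr0 -mem_hyperplane; apply: pbs.
  move: cbs; rewrite inE => /orP[/eqP cb|//]; move: qb.
  by rewrite mem_hyperplane -/(dot _ _) -cb qc0 eqxx.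
apply: contraNN tP => /eqP/addr0_eq E; apply/mapP; exists c => //.
by rewrite E mulfK.
Qed.

End Localization.

(** * Local freeness of the sheaf *)

Section ProjPoints.

Variables (k : closedFieldType) (n : nat).
Local Notation R := {mpoly k[n.+1]}.
Local Notation point := (proj_point k n).
Implicit Types (f g : R) (p q : point) (U V : point -> Prop).

Lemma proj_notM p f g : ~ p f -> ~ p g -> ~ p (f * g).
Proof. by move=> pf pg /ideal_prime[]. Qed.

Lemma proj_not_prod p (I : finType) (F : I -> R) :
  (forall i, ~ p (F i)) -> ~ p (\prod_i F i).
Proof. by move=> h; elim/big_ind: _ => //; [exact: ideal_proper|exact: proj_notM]. Qed.

Lemma proj_notX p f m : ~ p f -> ~ p (f ^+ m).
Proof.
move=> pf; elim: m => [|m IH]; first by rewrite expr0; exact: ideal_proper.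
by rewrite exprS; apply: proj_notM.
Qed.

Lemma proj_not_neq0 p f : ~ p f -> f != 0.
Proof. by move=> pf; apply/eqP => f0; apply: pf; rewrite f0; exact: ideal0. Qed.

Lemma proj_sum p (I : finType) (F : I -> R) : (forall i, p (F i)) -> p (\sum_i F i).
Proof. by move=> h; elim/big_ind: _ => //; [exact: ideal0|exact: idealD]. Qed.

Lemma proj_scale p c f : p f -> p (c *: f).
Proof. by rewrite -mul_mpolyC; exact: idealM. Qed.

Lemma homogM f g : f \is homog mdeg -> g \is homog mdeg -> f * g \is homog mdeg.
Proof.
case/homogP => d fd /homogP[e ge]; apply/homogP; exists (d + e)%N; exact: dhomogM.
Qed.

Lemma homog1 : (1 : R) \is homog mdeg.
Proof. by apply/homogP; exists 0%N; exact: dhomog1. Qed.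

Lemma homog_bigprod (I : finType) (F : I -> R) :
  (forall i, F i \is homog mdeg) -> \prod_i F i \is homog mdeg.
Proof. by move=> h; elim/big_ind: _ => //; [exact: homog1|exact: homogM]. Qed.

Lemma proj_open_neq0 f : f \is homog mdeg -> proj_open (fun p : point => ~ p f).
Proof.
move=> fh; exists (fun g => g = f); split=> [g -> //|p].
by split=> [pf|[g ->]//]; exists f.
Qed.

Lemma proj_openI U V : proj_open U -> proj_open V -> proj_open (fun p => U p /\ V p).
Proof.
case=> S [Sh SU] [T [Th TV]].
exists (fun h => exists f g, [/\ S f, T g & h = f * g]); split.
  by move=> _ [f [g [/Sh fh /Th gh ->]]]; exact: homogM.
move=> p; split=> [[/SU[f Sf pf] /TV[g Tg pg]]|[_ [f [g [Sf Tg ->]]] pfg]].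
  by exists (f * g); [exists f, g|exact: proj_notM].
split; first by apply/SU; exists f => // pf; apply: pfg; rewrite mulrC; exact: idealM.
by apply/TV; exists g => // pg; apply: pfg; exact: idealM.
Qed.

Lemma proj_open_forall r (V : 'I_r -> point -> Prop) :
  (forall j, proj_open (V j)) -> proj_open (fun p => forall j, V j p).
Proof.
elim: r V => [|r IH] V Vo.
  exists (fun f => f = 1); split=> [_ ->|p]; first exact: homog1.
  by split=> [_|_ []//]; exists 1 => //; exact: ideal_proper.
have [S [Sh SV]] := proj_openI (Vo ord0) (IH (fun j => V (lift ord0 j)) (fun j => Vo _)).
exists S; split=> // p; rewrite -SV; split=> [Vp|[V0 Vl] j]; first by split.
by case: (unliftP ord0 j) => [i|] ->.
Qed.

Section Line.

Variable v : 'I_n.+1 -> k.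

(** The restriction of f to the line spanned by v. Its coefficients are the values at v of the
    homogeneous components of f, so the kernel is a homogeneous prime. *)
Definition line f : {poly k} := mmap (@polyC k) (fun i => (v i)%:P * 'X) f.

HB.instance Definition _ := GRing.RMorphism.copy line
  (mmap (@polyC k) (fun i => (v i)%:P * 'X)).

Lemma line_homog d f : f \is d.-homog -> line f = (f.@[v])%:P * 'X^d.
Proof.
move/dhomogP => fd; rewrite /line /mmap mevalE raddf_sum mulr_suml big_seq [RHS]big_seq.
apply: eq_bigr => m /fd <- /=; rewrite polyCM -mulrA; congr (_ * _).
rewrite /mmap1 mdegE rmorph_prod /= -prodrXr -big_split; apply: eq_bigr => i _ /=.
by rewrite exprMn -rmorphXn.
Qed.

Lemma coef_line d f : (line f)`_d = (pihomog mdeg d f).@[v].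
Proof.
set K := maxn (msize f) d.+1.
rewrite {1}(@pihomog_partitionE _ _ mdeg K f) ?leq_maxl // raddf_sum coef_sum /=.
have dK : (d < K)%N by rewrite leq_max leqnn orbT.
under eq_bigr do rewrite (line_homog (pihomogP _ _ _)) coefCM coefXn.
rewrite (bigD1 (Ordinal dK)) //= eqxx mulr1 big1 ?addr0 // => j jd.
by rewrite eq_sym; have /negPf := jd; rewrite -val_eqE /= => ->; rewrite mulr0.
Qed.

Hypothesis v0 : exists i, v i != 0.

(* The homogeneous prime ideal of a closed point: the polynomials vanishing on
   the line through [v]. *)
Definition closed_point : point.
Proof.
apply: (@ProjPoint k n (fun f => line f = 0)).
- exact: rmorph0.
- by move=> f g f0 g0; rewrite rmorphD /= f0 g0 addr0.
- by move=> f g g0; rewrite rmorphM /= g0 mulr0.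
- move=> d f f0; rewrite (line_homog (pihomogP _ _ _)) -coef_line f0 coef0.
  by rewrite polyC0 mul0r.
- by rewrite rmorph1; apply/eqP; exact: oner_neq0.
- by move=> f g; rewrite rmorphM /= => /eqP; rewrite mulf_eq0 => /orP[]/eqP; [left|right].
- have [i vi] := v0; exists i; rewrite /line mmapX mmap1U => /eqP.
  by rewrite mulf_eq0 polyC_eq0 polyX_eq0 orbF (negPf vi).
Defined.

Lemma closed_pointP f : f \is homog mdeg -> ~ closed_point f <-> f.@[v] != 0.
Proof.
case/homogP => d /line_homog; rewrite /= => ->; split=> [h|f0 /eqP].
  by apply/eqP => f0; apply: h; rewrite f0 polyC0 mul0r.
by rewrite mulf_eq0 polyC_eq0 (negPf f0) expf_eq0 polyX_eq0 andbF.
Qed.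

End Line.

Section Combination.

Variables (M : graded_module k n) (E : gcarrier M -> Prop).
Hypothesis E0 : E 0.
Hypothesis ED : forall x y, E x -> E y -> E (x + y).
Hypothesis EZ : forall f x, E x -> E (f *: x).

Lemma comb_den r (x : 'I_r -> fraction M) :
  (\big[@fraction_add k n M/(0, 1)]_i x i).2 = \prod_i (x i).2.
Proof. by apply: (big_morph (fun y : fraction M => y.2)). Qed.

(** Division-free addition: if each x_i equals v_i / D modulo E, the sum of the x_i equals the sum
    of the v_i over D. Fractions are never simplified, so D and the denominator of the sum are kept
    apart. *)
Lemma comb_num r (x : 'I_r -> fraction M) (D : R) (v : 'I_r -> gcarrier M) :
  (forall i, E (D *: (x i).1 - (x i).2 *: v i)) ->
  let s := \big[@fraction_add k n M/(0, 1)]_i x i in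
  E (D *: s.1 - s.2 *: \sum_i v i).
Proof.
move=> h /=; apply: (big_ind2 (fun (s : fraction M) w => E (D *: s.1 - s.2 *: w))) => //.
  by rewrite !scaler0 subr0.
move=> y a z b Ey Ez /=.
have -> : D *: (z.2 *: y.1 + y.2 *: z.1) - (y.2 * z.2) *: (a + b) =
  z.2 *: (D *: y.1 - y.2 *: a) + y.2 *: (D *: z.1 - z.2 *: b).
  rewrite !scalerDr !scalerN !scalerA [z.2 * D]mulrC [y.2 * D]mulrC [z.2 * y.2]mulrC.
  by rewrite opprD addrACA.
by apply: ED; apply: EZ.
Qed.

End Combination.

End ProjPoints.

(** * From local frames of the sheaf to local generators of the derivations *)

Section LocallyFreeGenerated.

Variables (k : closedFieldType) (n : nat) (A : seq 'rV[k]_n.+1).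
Local Notation R := {mpoly k[n.+1]}.
Local Notation point := (proj_point k n).
Local Notation M := (Der_log0 A).
Implicit Types (f g : R) (theta : 'rV[R]_n.+1) (q : point) (U V : point -> Prop).

Definition euler_line theta := exists f, theta = f *: euler k n.

Lemma euler_line0 : euler_line 0.
Proof. by exists 0; rewrite scale0r. Qed.

Lemma euler_lineD theta eta : euler_line theta -> euler_line eta -> euler_line (theta + eta).
Proof. by case=> f -> [g ->]; exists (f + g); rewrite scalerDl. Qed.

Lemma euler_lineZ f theta : euler_line theta -> euler_line (f *: theta).
Proof. by case=> g ->; exists (f * g); rewrite scalerA. Qed.

Lemma euler_lineN theta : euler_line theta -> euler_line (- theta).
Proof. by rewrite -scaleN1r; exact: euler_lineZ. Qed.

Lemma const_section (N : graded_module k n) U (x : fraction N) : Defs.grel (0 : gcarrier N) -> proj_open U ->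
  (forall q, U q -> stalk_elt q x) -> is_section U (fun=> x).
Proof.
move=> N0 Uo xU; split=> // q Uq; exists U; split=> //; exists x => q' Uq'; split; first exact: xU.
exists 1; split; [exact: homog1|exact: ideal_proper|].
by rewrite subrr scaler0.
Qed.

Lemma X_homog i m : ('X_i : R) ^+ m \is m.-homog.
Proof.
have : ('X_i : R) \is 1.-homog by rewrite dhomogX /= mdeg1.
by move/(dhomogMn m); rewrite mul1n.
Qed.

Lemma pihomog_neq0 f : f != 0 -> exists d, pihomog mdeg d f != 0.
Proof.
move=> f0; apply: NNPP => h; move/eqP: f0; apply.
rewrite (@pihomog_partitionE _ _ mdeg (msize f) f) // big1 // => d _.
by apply/eqP; apply: NNPP => /negP hd; apply: h; exists d.
Qed.

Lemma stalk_elt_const q d theta f : arrangement A -> log_der A theta ->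
  row_homog d.+1 theta -> f \is d.-homog -> ~ q f -> @stalk_elt k n M q (theta, f).
Proof. by move=> arrA thA thd fd qf; exists d; split=> //; split=> //; apply/Der_logP. Qed.

Section Chart.

Variables (U : point -> Prop) (r : nat) (e : 'I_r -> point -> fraction M).
Hypothesis arrA : arrangement A.
Hypothesis Uo : proj_open U.
Hypothesis esec : forall j, is_section U (e j).
Hypothesis efree : forall V : point -> Prop, proj_open V -> (forall p, V p -> U p) ->
    forall s : point -> fraction M, is_section V s ->
    exists c : 'I_r -> point -> fraction (structure_module k n),
      [/\ forall i, is_section V (c i),
          section_eq V s (section_comb c e) &
          forall c' : 'I_r -> point -> fraction (structure_module k n),
            (forall i, is_section V (c' i)) ->
            section_eq V s (section_comb c' e) ->
            forall i, section_eq V (c i) (c' i)].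

Variables (v : 'I_n.+1 -> k) (v0 : exists i, v i != 0).
Local Notation P := (closed_point v0).
Variables (V : 'I_r -> point -> Prop) (u : 'I_r -> 'rV[R]_n.+1) (t : 'I_r -> R) (d : 'I_r -> nat).
Hypothesis UP : U P.
Hypothesis Vo : forall j, proj_open (V j).
Hypothesis VP : forall j, V j P.
Hypothesis eV : forall j q, V j q -> @stalk_eq k n M q (e j q) (u j, t j).
Hypothesis uA : forall j, log_der A (u j).
Hypothesis ud : forall j, row_homog (d j).+1 (u j).
Hypothesis td : forall j, t j \is (d j).-homog.
Hypothesis tP : forall j, ~ P (t j).

Variable i : 'I_n.+1.
Hypothesis vi : v i != 0.

Lemma X_notin_P : ~ P 'X_i.
Proof.
apply/closed_pointP; last by rewrite mevalXU.
by apply/homogP; exists 1%N; rewrite -['X_i]expr1; exact: X_homog.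
Qed.

(** The numerators of the frame, with the Euler derivation restored, since the frame generates only
    modulo it. *)
Definition chart_gen (l : 'I_r.+1) := if unlift ord0 l is Some j then u j else euler k n.

Lemma span_chart_gen j : span chart_gen (u j).
Proof.
have -> : u j = chart_gen (lift ord0 j) by rewrite /chart_gen liftK.
exact: span_mem.
Qed.

Lemma span_chart_euler theta : euler_line theta -> span chart_gen theta.
Proof.
case=> f ->; apply: spanZ.
have -> : euler k n = chart_gen ord0 by rewrite /chart_gen unlift_none.
exact: span_mem.
Qed.

(** Over a power of ['X_i], [theta] becomes a section and expands in the frame; clearing
    denominators at the closed point of v costs only a factor nonzero at v. *)
Lemma stalk_generated dth theta : log_der A theta -> row_homog dth.+1 theta ->
  exists2 g, g.@[v] != 0 & span chart_gen (g *: theta).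
Proof.
move=> thA thd; pose W q := U q /\ ~ q 'X_i.
have Wo : proj_open W.
  apply: proj_openI => //; apply: proj_open_neq0.
  by apply/homogP; exists 1%N; rewrite -['X_i]expr1; exact: X_homog.
pose s (q : point) : fraction M := (theta, 'X_i ^+ dth).
have ssec : is_section W s.
  apply: const_section => //; first exact: euler_line0.
  move=> q [_ qX]; apply: stalk_elt_const thd _ _ => //; first exact: X_homog.
  exact: proj_notX.
have [c [csec ceq _]] := @efree W Wo (fun q Wq => proj1 Wq) s ssec.
have WP : W P by split=> //; exact: X_notin_P.
have [w [wh wP wE]] := ceq P WP.
have [ww wwP] := choice_fun (fun j => eV (VP j)).
pose a j : R := (c j P).1; pose b j : R := (c j P).2.
pose y j : 'rV[R]_n.+1 := (e j P).1; pose z j : R := (e j P).2.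
have bP j : b j \is homog mdeg /\ ~ P (b j).
  by have [? [_ bh bP]] := proj1 (csec j) _ WP; split=> //; exact: homogE bh.
have zP j : z j \is homog mdeg /\ ~ P (z j).
  by have [? [_ zh zP]] := proj1 (esec j) _ UP; split=> //; exact: homogE zh.
(* [F j] clears the j-th term: [ww j] witnesses e_j = u_j / t_j in the stalk at P, while [b j] and
   [z j] are the denominators of c_j and e_j. *)
pose F j := ww j * t j * b j * z j.
have FP j : F j \is homog mdeg /\ ~ P (F j).
  have [wjh wjP _] := wwP j; have [bh bj] := bP j; have [zh zj] := zP j.
  split; last by do !apply: proj_notM => //; exact: tP.
  by do !apply: homogM => //; exact: homogE (td j).
pose D := \prod_j F j; pose K j := \prod_(l | l != j) F l.
have DK j : D = F j * K j by rewrite /D (bigD1 j).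
set cc := section_comb c e P in wE.
have Ecc : euler_line (D *: cc.1 - cc.2 *: \sum_j ((K j * ww j * a j * z j) *: u j)).
  apply: (@comb_num _ _ M euler_line euler_line0 euler_lineD euler_lineZ) => j /=.
  have [_ _ Ej] := wwP j; rewrite -/(a j) -/(b j) -/(y j) -/(z j) (DK j) /F.
  have := euler_lineZ (K j * b j * z j * a j) Ej; rewrite /= -/(y j) -/(z j).
  congr euler_line; rewrite !scalerBr !scalerA; congr (_ *: _ - _ *: _); ring.
have ccP : cc.2 \is homog mdeg /\ ~ P cc.2.
  rewrite /cc /section_comb comb_den; split.
    by apply: homog_bigprod => j; exact: (homogM (proj1 (bP j)) (proj1 (zP j))).
  by apply: proj_not_prod => j; exact: (proj_notM (proj2 (bP j)) (proj2 (zP j))).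
exists (w * D * cc.2).
  apply/(closed_pointP v0).
    apply: homogM; last exact: (proj1 ccP); apply: homogM => //.
    by apply: homog_bigprod => j; exact: (proj1 (FP j)).
  apply: proj_notM; last exact: (proj2 ccP); apply: proj_notM => //.
  by apply: proj_not_prod => j; exact: (proj2 (FP j)).
set S := \sum_j _ in Ecc.
have -> : (w * D * cc.2) *: theta = D *: (w *: (cc.2 *: theta - 'X_i ^+ dth *: cc.1)) +
   (w * 'X_i ^+ dth) *: (D *: cc.1 - cc.2 *: S) + (w * 'X_i ^+ dth * cc.2) *: S.
  by clear; move: S => S; apply/rowP => l; rewrite !mxE; ring.
apply: spanD; [apply: spanD|].
- by apply/spanZ/span_chart_euler.
- by apply/spanZ/span_chart_euler.
by apply/spanZ/span_sum => j _; apply/spanZ/span_chart_gen.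
Qed.

Lemma local_span_sum (I : finType) (F : I -> 'rV[R]_n.+1) :
  (forall j, exists2 g, g.@[v] != 0 & span chart_gen (g *: F j)) ->
  exists2 g, g.@[v] != 0 & span chart_gen (g *: \sum_j F j).
Proof.
move=> h; elim/big_ind: _ => [|x y [f fv fx] [g gv gy]|j _]; last exact: h.
  by exists 1; rewrite ?meval1 ?oner_neq0 // scaler0; exact: span0.
exists (f * g); first by rewrite mevalM mulf_neq0.
rewrite scalerDr; apply: spanD; last by rewrite -scalerA; exact: spanZ.
by rewrite mulrC -scalerA; exact: spanZ.
Qed.

Lemma chart_generated theta : log_der A theta ->
  exists2 g, g.@[v] != 0 & span chart_gen (g *: theta).
Proof.
move=> thA; rewrite (@row_part_partition _ _ (\max_j msize (theta 0%R j)) theta); last first.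
  by move=> j; exact: (leq_bigmax j).
apply: local_span_sum => -[[|m] mK] /=; last first.
  by apply: (@stalk_generated m); [exact: log_der_part|exact: row_part_homog].
(* A derivation with constant coefficients has degree -1 and lies in no recorded piece;
   multiplication by ['X_i], a unit at v, moves it to degree 0. *)
have X1 : ('X_i : R) \is 1.-homog by rewrite -['X_i]expr1; exact: X_homog.
have [||g gv gs] := @stalk_generated 0 ('X_i *: row_part 0 theta).
- by apply/log_derZ/log_der_part.
- have := row_homog_scale X1 (row_part_homog 0 theta); by rewrite addn0.
by exists (g * 'X_i); rewrite ?mevalM ?mevalXU ?mulf_neq0 // -scalerA.
Qed.

(** A relation modulo Euler among the numerators u_j becomes an expansion of the zero section: the
    factors t_j undo the denominators of the frame. *)
Lemma chart_zero_comb (W : point -> Prop) (c : 'I_r -> R) m :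
  (forall q, W q -> (forall j, V j q) /\ ~ q 'X_i) ->
  euler_line (\sum_j c j *: u j) ->
  section_eq W (fun=> (0, 1) : fraction M)
    (section_comb (fun j _ => (c j * t j, 'X_i ^+ m) : fraction (structure_module k n)) e).
Proof.
move=> WV cE q Wq; have [Vq qX] := WV q Wq.
have [w wP] := choice_fun (fun j => eV (Vq j)).
pose D := 'X_i ^+ m * \prod_j w j.
exists D; split.
- apply: homogM; first by apply/homogP; exists m; exact: X_homog.
  by apply: homog_bigprod => j; have [] := wP j.
- by apply: proj_notM; [exact: proj_notX|apply: proj_not_prod => j; have [] := wP j].
set cc := section_comb _ e q.
have : euler_line (D *: cc.1 - cc.2 *: \sum_j ((\prod_l w l * c j) *: u j)).
  apply: (@comb_num _ _ M euler_line euler_line0 euler_lineD euler_lineZ) => j /=.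
  have [_ _ Ej] := wP j; set K := \prod_(l | l != j) w l.
  have -> : D = 'X_i ^+ m * (w j * K) by rewrite /D (bigD1 j).
  have -> : \prod_l w l = w j * K by rewrite (bigD1 j).
  have := euler_lineZ ('X_i ^+ m * K * c j) Ej.
  by congr euler_line; apply/rowP => l; rewrite !mxE /=; ring.
have -> : \sum_j (\prod_l w l * c j) *: u j = \prod_l w l *: \sum_j c j *: u j.
  by rewrite scaler_sumr; apply: eq_bigr => j _; rewrite scalerA.
move=> E1.
have := euler_lineN (euler_lineD E1 (euler_lineZ (cc.2 * \prod_l w l) cE)).
suff E2 : - (D *: cc.1 - cc.2 *: (\prod_l w l *: \sum_j c j *: u j) +
  (cc.2 * \prod_l w l) *: \sum_j c j *: u j) = D *: (cc.2 *: 0 - 1 *: cc.1).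
  by rewrite E2.
by rewrite scale1r scaler0 sub0r scalerN -scalerA addrNK.
Qed.

(** Otherwise Euler and the u_j are more than n+1 vectors of length n+1, hence dependent; a
    homogeneous component of the relation expands the zero section with a nonzero coefficient,
    against uniqueness. *)
Lemma chart_rank : (r < n.+1)%N.
Proof.
rewrite ltnNge; apply/negP => nr.
have [rho rho0 rhoM] := @kernel_vector _ _ _ (\matrix_l chart_gen l) (nr : (n.+1 < r.+1)%N).
have rel : rho 0 ord0 *: euler k n + \sum_j rho 0 (lift ord0 j) *: u j = 0.
  rewrite -[RHS]rhoM; have -> : rho = \row_l rho 0 l by apply/rowP => l; rewrite mxE.
  rewrite -span_matrix big_ord_recl !mxE; congr (_ *: _ + _).
    by rewrite /chart_gen unlift_none.
  by apply: eq_bigr => j _; rewrite !mxE /chart_gen liftK.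
have [j0 rj0] : exists j, rho 0 (lift ord0 j) != 0.
  apply: NNPP => h; case/eqP: rho0; apply/rowP.
  have hj j : rho 0 (lift ord0 j) = 0.
    by apply/eqP; apply: NNPP => /negP hj; apply: h; exists j.
  move=> l; rewrite mxE; case: (unliftP ord0 l) => [j|] -> //.
  move: rel; rewrite big1 => [|j _]; last by rewrite hj scale0r.
  rewrite addr0 => /rowP/(_ i); rewrite !mxE => /eqP.
  by rewrite mulf_eq0 (negPf (proj_not_neq0 X_notin_P)) orbF => /eqP.
have [m cm] := pihomog_neq0 rj0.
(* In degree D the nonzero component of degree m survives in c_j0. Every c_j t_j then has degree D -
   1, whence the denominator ['X_i ^+ D.-1] below. *)
pose D := (m + (d j0).+1)%N; pose c j := gshift D (d j).+1 (rho 0 (lift ord0 j)).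
have cj0 : c j0 != 0 by rewrite /c /gshift leq_addl addnK.
have cE : euler_line (\sum_j c j *: u j).
  have := congr1 (row_part D) rel; rewrite row_part0 row_partD row_part_sum.
  rewrite (row_part_scale _ _ (@euler_homog k n)) addrC => /eqP; rewrite addr_eq0 => /eqP E.
  exists (- gshift D 1 (rho 0 ord0)); rewrite scaleNr -E.
  by apply: eq_bigr => j _; rewrite (row_part_scale _ _ (ud j)).
pose W q := (forall j, V j q) /\ (U q /\ ~ q 'X_i).
have Wo : proj_open W.
  apply: proj_openI; first exact: proj_open_forall.
  apply: proj_openI => //; apply: proj_open_neq0.
  by apply/homogP; exists 1%N; rewrite -['X_i]expr1; exact: X_homog.
pose s (q : point) : fraction M := (0, 1).
have ssec : is_section W s.
  apply: const_section => //; first exact: euler_line0.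
  move=> q _; apply: (@stalk_elt_const q 0) => //; last exact: ideal_proper.
  - exact: log_der0.
  - by move=> j; rewrite mxE; exact: rpred0.
  - exact: dhomog1.
have WV q : W q -> (forall j, V j q) /\ ~ q 'X_i by case=> ? [].
have csec : forall j, is_section W (fun=> (c j * t j, 'X_i ^+ D.-1) : fraction (structure_module k n)).
  move=> j; apply: const_section => // q [_ [_ qX]]; exists D.-1; split.
  - rewrite /= /c /gshift; case: ifP => [le|_]; last by rewrite mul0r; exact: rpred0.
    have -> : D.-1 = (D - (d j).+1 + d j)%N.
      by rewrite -[in LHS](subnK le) addnS.
    by apply: dhomogM => //; exact: pihomogP.
  - exact: X_homog.
  - exact: proj_notX.
have zsec : forall j, is_section W (fun=> (0 * t j, 'X_i ^+ 0) : fraction (structure_module k n)).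
  move=> j; apply: const_section => // q _; exists 0%N; split.
  - by rewrite /= mul0r; exact: rpred0.
  - exact: dhomog1.
  - exact: ideal_proper.
(* Uniqueness is relative to the family c1, so both the relation and the zero family are compared
   with it. *)
have [c1 [c1sec _ uniq]] := @efree W Wo (fun q Wq => proj1 (proj2 Wq)) s ssec.
have WP : W P by split=> //; split=> //; exact: X_notin_P.
have zE : euler_line (\sum_j (0 : R) *: u j).
  by rewrite big1 => [|j _]; [exact: euler_line0|rewrite scale0r].
have [w1 [_ /proj_not_neq0 w1P]] := uniq _ csec (chart_zero_comb _ WV cE) j0 P WP.
have [w2 [_ /proj_not_neq0 w2P]] := uniq _ zsec (chart_zero_comb _ WV zE) j0 P WP.
have [? [_ _ /proj_not_neq0 bP]] := proj1 (c1sec j0) P WP.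
move: bP; rewrite /=; move: (c1 j0 P) => [/= a b] b0.
rewrite mul0r scaler0 subr0 => /eqP; rewrite scale1r.
rewrite !mulf_eq0 (negPf w2P) /= => /eqP ->.
rewrite scaler0 sub0r => /eqP; rewrite scalerN oppr_eq0 !mulf_eq0.
by rewrite (negPf w1P) (negPf b0) (negPf cj0) (negPf (proj_not_neq0 (@tP j0))).
Qed.

Lemma chart_locally_generated : locally_generated A v.
Proof.
exists r.+1, chart_gen; split=> [|l|theta]; first exact: chart_rank.
  by rewrite /chart_gen; case: unlift => [j|] //; exact: log_der_euler.
exact: chart_generated.
Qed.

End Chart.

Lemma locally_free_generated v : arrangement A -> (exists i, v i != 0) ->
  locally_free_arrangement A -> locally_generated A v.
Proof.
move=> arrA v0 /(_ (closed_point v0))[U [Uo UP [r [e [esec efree]]]]].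
have [i vi] := v0.
have [V VP] := choice_fun (fun j => proj2 (esec j) _ UP).
have xex j : exists x : fraction (Der_log0 A), forall q, V j q -> stalk_elt q x /\ stalk_eq q (e j q) x.
  by have [] := VP j.
have [x xP] := choice_fun xex.
have VjP j : V j (closed_point v0) by have [] := VP j.
have [d dP] := choice_fun (fun j => proj1 (xP j _ (VjP j))).
apply: (@chart_locally_generated U r e arrA Uo esec efree v v0 V
  (fun j => (x j).1) (fun j => (x j).2) d UP _ VjP _ _ _ _ _ i vi).
- by move=> j; have [] := VP j.
- by move=> j q Vq; have [_] := xP j q Vq; case: (x j).
- by move=> j; have [[/(Der_logP _ arrA)]] := dP j.
- by move=> j; have [[]] := dP j.
- by move=> j; have [] := dP j.
- by move=> j; have [] := dP j.
Qed.

End LocallyFreeGenerated.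

(** * From homogeneous bases to local frames of the sheaf *)

Section Trivialization.

Variables (k : closedFieldType) (n : nat) (A : seq 'rV[k]_n.+1).
Local Notation R := {mpoly k[n.+1]}.
Local Notation point := (proj_point k n).
Local Notation M := (Der_log0 A).
Local Notation O := (structure_module k n).
Implicit Types (f g : R) (theta : 'rV[R]_n.+1) (q : point) (U V : point -> Prop).

Hypothesis arrA : arrangement A.

Lemma lincomb_sub (I : finType) (u : I -> 'rV[R]_n.+1) (b c : I -> R) f g h :
  \sum_j (h * (f * b j - g * c j)) *: u j =
  h *: (f *: (\sum_j b j *: u j) - g *: \sum_j c j *: u j).
Proof.
rewrite !scaler_sumr -sumrB scaler_sumr; apply: eq_bigr => j _.
by rewrite -scalerA scalerBl !scalerA.
Qed.

Section Chart.

Variables (F : R) (phi r : nat) (u : 'I_r -> 'rV[R]_n.+1) (t : 'I_r -> R) (d : 'I_r -> nat).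
Hypothesis Fh : F \is phi.-homog.
Hypothesis uA : forall j, log_der A (u j).
Hypothesis ud : forall j, row_homog (d j).+1 (u j).
Hypothesis td : forall j, t j \is (d j).-homog.
Hypothesis tU : forall q j, ~ q F -> ~ q (t j).
Hypothesis uspan : forall theta, log_der A theta ->
  exists c : 'I_r -> R, euler_line (F *: theta - \sum_j c j *: u j).
Hypothesis uind : forall c : 'I_r -> R, euler_line (\sum_j c j *: u j) -> forall j, c j = 0.

(** The degree is quantified inside, so that choice yields coefficients depending on [theta] alone.
    A nonzero homogeneous [theta] has a single degree; the zero derivation has all of them and gets
    zero coefficients. *)
Lemma chart_coef_exists theta : exists c : 'I_r -> R, log_der A theta ->
  forall m, row_homog m.+1 theta -> euler_line (F *: theta - \sum_j c j *: u j) /\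
  forall j, c j * t j \is (phi + m).-homog.
Proof.
have [->|th0] := eqVneq theta 0.
  exists (fun=> 0) => _ m _; split=> [|j]; last by rewrite mul0r; exact: rpred0.
  rewrite scaler0 sub0r big1 ?oppr0 => [|j _]; first exact: euler_line0.
  by rewrite scale0r.
apply: NNPP => h; apply: h; have [thA|thA] := classic (log_der A theta); last by exists (fun=> 0).
have [[m thm]|nth] := classic (exists m, row_homog m.+1 theta); last first.
  by exists (fun=> 0) => _ m thm; case: nth; exists m.
have [b [f E]] := uspan thA; pose c j := gshift (phi + m).+1 (d j).+1 (b j).
exists c => _ m' thm'.
have <- : m = m'.
  have [l thl] : exists l, theta 0 l != 0.
    apply: NNPP => h; case/eqP: th0; apply/rowP => l; rewrite mxE; apply/eqP.
    by apply: NNPP => /negP hl; apply: h; exists l.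
  by have [] := dhomog_uniq thl (thm l) (thm' l).
split=> [|j]; last first.
  rewrite /c /gshift; case: ifP => [le|_]; last by rewrite mul0r; exact: rpred0.
  rewrite subSS; have {2}-> : (phi + m = phi + m - d j + d j)%N by rewrite subnK.
  by apply: dhomogM => //; exact: pihomogP.
exists (gshift (phi + m).+1 1 f).
have := congr1 (row_part (phi + m).+1) E.
rewrite row_partB (row_part_scale _ _ (@euler_homog k n)) => <-.
congr (_ - _).
  by rewrite row_part_id //; have := row_homog_scale Fh thm; rewrite addnS.
by rewrite row_part_sum; apply: eq_bigr => j _; rewrite (row_part_scale _ _ (ud j)).
Qed.

Local Notation U := (fun q : point => ~ q F).

(** In the frame u_j / t_j, a fraction theta / f has coordinates kap_j t_j / (F f). Independence of
    the u_j modulo Euler makes these compatible with equality of fractions and forces uniqueness. *)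
Lemma chart_free_sheaf : free_sheaf_on M U r.
Proof.
have [kap kapP] := choice_fun chart_coef_exists.
have kap_piece m theta : @gpiece k n M m theta ->
    euler_line (F *: theta - \sum_j kap theta j *: u j) /\
    forall j, kap theta j * t j \is (phi + m).-homog.
  by case=> /(Der_logP _ arrA) thA thm; exact: kapP.
have elt_kap q (x : fraction M) j : U q -> stalk_elt q x ->
    @stalk_elt k n O q (kap x.1 j * t j, F * x.2).
  move=> Uq [m [/kap_piece[_ kh] xh qx]]; exists (phi + m)%N; split.
  - exact: kh.
  - exact: dhomogM Fh xh.
  - exact: proj_notM.
have eq_kap q (x y : fraction M) j : stalk_elt q x -> stalk_elt q y -> stalk_eq q x y ->
    y.2 * kap x.1 j = x.2 * kap y.1 j.
  case=> m [/kap_piece[Ex _] _ _] [m' [/kap_piece[Ey _] _ _]] [w [_ /proj_not_neq0 w0 Ew]].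
  suff : w * (y.2 * kap x.1 j - x.2 * kap y.1 j) = 0.
    by move/eqP; rewrite mulf_eq0 (negPf w0) subr_eq0 => /eqP.
  apply: (uind (c := fun j => w * (y.2 * kap x.1 j - x.2 * kap y.1 j))).
  have E1 := euler_lineZ (- (w * y.2)) Ex.
  have E2 := euler_lineZ (w * x.2) Ey.
  have E3 := euler_lineZ F Ew.
  have := euler_lineD (euler_lineD E1 E2) E3; congr euler_line => {E1 E2 E3 Ex Ey Ew}.
  rewrite lincomb_sub; move: (\sum_i kap x.1 i *: u i) (\sum_i kap y.1 i *: u i) => X Y.
  by apply/rowP => l; rewrite !mxE; ring.
exists (fun j _ => (u j, t j)); split=> [j|V Vo VU s ssec].
  apply: const_section; first exact: euler_line0.
    by apply: proj_open_neq0; exact: homogE Fh.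
  by move=> q Uq; apply: stalk_elt_const (ud j) (td j) _ => //; exact: tU.
exists (fun j p => (kap (s p).1 j * t j, F * (s p).2)); split.
- move=> j; split=> [p Vp|p Vp].
    by apply: elt_kap; [exact: VU|exact: (proj1 ssec)].
  have [V' [V'o V'p V'V [x xP]]] := proj2 ssec p Vp.
  exists V'; split=> //; exists (kap x.1 j * t j, F * x.2) => q V'q.
  have [xq sx] := xP q V'q; split; first exact: (elt_kap _ _ _ (VU _ (V'V _ V'q)) xq).
  exists 1; split; [exact: homog1|exact: ideal_proper|rewrite /=].
  have := eq_kap q _ _ j (proj1 ssec _ (V'V _ V'q)) xq sx.
  move: (s q) => [th tau] /= E; rewrite scale1r; apply/eqP; rewrite subr_eq0; apply/eqP.
  have -> : (F * x.2) *: (kap th j * t j : R^o) = F * t j * (x.2 * kap th j).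
    by rewrite /GRing.scale /=; ring.
  by rewrite E /GRing.scale /=; ring.
- move=> p Vp; have [m [/kap_piece[Es _] _ _]] := proj1 ssec p Vp.
  exists F; split; [exact: homogE Fh|exact: VU|].
  set cc := section_comb _ _ p.
  have Ecc : euler_line ((F * (s p).2) *: cc.1 - cc.2 *: \sum_j kap (s p).1 j *: u j).
    apply: (@comb_num _ _ M (@euler_line k n) (@euler_line0 k n)
      (@euler_lineD k n) (@euler_lineZ k n)) => j.
    suff -> : (F * (s p).2) *: ((kap (s p).1 j * t j) *: u j) -
        (F * (s p).2 * t j) *: (kap (s p).1 j *: u j) = 0 by exact: euler_line0.
    by apply/rowP => l; rewrite !mxE; ring.
  set S := \sum_j kap (s p).1 j *: u j in Es Ecc.
  suff -> : F *: (cc.2 *: (s p).1 - (s p).2 *: cc.1) =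
      cc.2 *: (F *: (s p).1 - S) + (- 1) *: ((F * (s p).2) *: cc.1 - cc.2 *: S).
    by apply: euler_lineD; exact: euler_lineZ.
  by apply/rowP => l; rewrite !mxE; ring.
move=> c' c'sec c'eq j p Vp.
have [m [/kap_piece[Es _] _ _]] := proj1 ssec p Vp.
have [w [_ /proj_not_neq0 w0 Ew]] := c'eq p Vp.
pose a l : R := (c' l p).1; pose b l : R := (c' l p).2.
have bp l : ~ p (b l) by have [? []] := proj1 (c'sec l) p Vp.
have D0 (P : pred 'I_r) : \prod_(l | P l) (b l * t l) != 0.
  by apply/prodf_neq0 => l _; apply: (@proj_not_neq0 _ _ p); apply: proj_notM => //; apply/tU/VU.
pose K l := \prod_(i | i != l) (b i * t i).
set cc := section_comb c' _ p in Ew; have DE l : cc.2 = b l * t l * K l by rewrite /cc /section_comb comb_den (bigD1 l).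
have Ecc : euler_line (cc.2 *: cc.1 - cc.2 *: \sum_l (K l * a l) *: u l).
  apply: (@comb_num _ _ M (@euler_line k n) (@euler_line0 k n)
      (@euler_lineD k n) (@euler_lineZ k n)) => l.
  suff -> : cc.2 *: (a l *: u l) - (b l * t l) *: ((K l * a l) *: u l) = 0 by exact: euler_line0.
  by rewrite (DE l); apply/rowP => i; rewrite !mxE; ring.
have : w * cc.2 * (cc.2 * kap (s p).1 j - F * (s p).2 * (K j * a j)) = 0.
  apply: (uind (c := fun l => w * cc.2 * (cc.2 * kap (s p).1 l - F * (s p).2 * (K l * a l)))).
  rewrite lincomb_sub; set S := \sum_j kap (s p).1 j *: u j in Es *.
  set T := \sum_l (K l * a l) *: u l in Ecc *.
  have -> : (w * cc.2) *: (cc.2 *: S - (F * (s p).2) *: T) =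
     (F * cc.2) *: (w *: (cc.2 *: (s p).1 - (s p).2 *: cc.1)) +
     (F * w * (s p).2) *: (cc.2 *: cc.1 - cc.2 *: T) - (w * cc.2 * cc.2) *: (F *: (s p).1 - S).
    by apply/rowP => l; rewrite !mxE; ring.
  apply: euler_lineD; last exact/euler_lineN/euler_lineZ.
  by apply: euler_lineD; exact: euler_lineZ.
have cc0 : cc.2 != 0 by rewrite (DE j) mulf_neq0 // ?D0 //; have := D0 (pred1 j); rewrite big_pred1_eq.
have K0 : K j != 0 by exact: D0.
move/eqP; rewrite !mulf_eq0 (negPf w0) (negPf cc0) /= (DE j).
have -> : b j * t j * K j * kap (s p).1 j - F * (s p).2 * (K j * a j) =
    K j * (b j * (kap (s p).1 j * t j) - F * (s p).2 * a j) by ring.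
rewrite mulf_eq0 (negPf K0) => /eqP E.
exists 1; split; [exact: homog1|exact: ideal_proper|].
by rewrite scale1r; exact: E.
Qed.

End Chart.

Lemma defining_poly_homog (B : seq 'rV[k]_n.+1) : defining_poly B \is (size B).-homog.
Proof.
rewrite /defining_poly; elim: B => [|b B IH]; first by rewrite big_nil; exact: dhomog1.
by rewrite big_cons; apply: (dhomogM (d := 1%N)) IH; exact: linear_form_homog.
Qed.

Lemma proj_not_defining_poly q (B : seq 'rV[k]_n.+1) :
  (forall b, b \in B -> ~ q (linear_form b)) -> ~ q (defining_poly B).
Proof.
rewrite /defining_poly; elim: B => [|b B IH] qB; first by rewrite big_nil; exact: ideal_proper.
rewrite big_cons; apply: proj_notM; first by apply: qB; exact: mem_head.
by apply: IH => c cB; apply: qB; rewrite inE cB orbT.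
Qed.

(** Not all variables lie in p, so some coordinate c_j0 of Euler in the homogeneous basis S lies
    outside p. Where c_j0 is a unit, Euler replaces S_j0; the other S_j become logarithmic along A
    once multiplied by the forms outside p. *)
Lemma locally_free_of_points :
  (forall p : point, exists2 A1, forall a, a \in A1 <-> a \in A /\ p (linear_form a) &
     locally_generated A1 (fun=> 0)) ->
  locally_free_arrangement A.
Proof.
move=> freeA p; have [A1 A1P /homog_basis_exists[S [ds [SA Sd Sgen]]]] := freeA p.
have [i Xi] := ideal_relevant p.
pose m := size [seq b <- A | b \notin A1]; pose f' := defining_poly [seq b <- A | b \notin A1].
have f'h : f' \is m.-homog by exact: defining_poly_homog.
have f'p : ~ p f'.
  apply: proj_not_defining_poly => b; rewrite mem_filter => /andP[/negP bA1 bA] pb.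
  by apply: bA1; apply/A1P.
have A10 a : a \in A1 -> a != 0 by case/A1P => aA _; exact: arrangement_neq0 aA.
have Xh : ('X_i : R) \is 1.-homog by rewrite -['X_i]expr1; exact: X_homog.
have [b0 b0E] := Sgen _ (@log_der_euler k n A1).
pose c j := gshift 1 (ds j) (b0 j).
have cE : euler k n = \sum_j c j *: S j.
  rewrite -(row_part_id (@euler_homog k n)) b0E row_part_sum; apply: eq_bigr => j _.
  by rewrite (row_part_scale _ _ (Sd j)).
have [j0 cj0] : exists j0, ~ p (c j0).
  apply: NNPP => h; apply: Xi.
  have -> : 'X_i = (euler k n) 0 i by rewrite mxE.
  rewrite cE summxE; apply: proj_sum => j; rewrite mxE mulrC; apply: idealM.
  by apply: NNPP => pc; apply: h; exists j.
have [e ce] : exists e, c j0 \is e.-homog.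
  rewrite /c /gshift; case: ifP => _; first by exists (1 - ds j0)%N; exact: pihomogP.
  by exists 0%N; exact: rpred0.
(* The factor ['X_i] raises degrees by one, so that even constant basis elements reach a recorded
   degree, and its powers serve as denominators of the frame. *)
pose F := 'X_i * f' * c j0.
have Fh : F \is (1 + m + e).-homog by rewrite /F; apply: dhomogM => //; apply: dhomogM.
exists (fun q => ~ q F); split.
- by apply: proj_open_neq0; exact: homogE Fh.
- by apply: proj_notM => //; apply: proj_notM.
exists n; pose T j := S (lift j0 j).
apply: (@chart_free_sheaf F _ n (fun j => ('X_i * f') *: T j)
  (fun j => 'X_i ^+ (m + ds (lift j0 j))) (fun j => m + ds (lift j0 j))%N Fh).
- move=> j a aA; have [aA1|aA1] := boolP (a \in A1).
    by apply: log_derZ aA1; exact: SA.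
  rewrite -scalerA; apply: log_derZ (log_der_defining_poly _) _ _.
  by rewrite mem_filter aA1.
- by move=> j; rewrite -add1n addnA; apply: row_homog_scale; [exact: dhomogM|exact: Sd].
- by move=> j; exact: X_homog.
- move=> q j qF; apply: proj_notX => qX; apply: qF.
  by rewrite /F -mulrA mulrC; exact: idealM.
- move=> theta thA.
  have [b bE] : span S theta by apply/Sgen/(log_der_sub _ thA) => a /A1P[].
  (* Elimination of S_j0 between the expansions of [theta] and of Euler. *)
  exists (fun j => c j0 * b (lift j0 j) - b j0 * c (lift j0 j)).
  exists ('X_i * f' * b j0).
  move: bE cE; rewrite !(bigD1_ord j0) //= => -> ->.
  have -> : \sum_j (c j0 * b (lift j0 j) - b j0 * c (lift j0 j)) *: (('X_i * f') *: T j) =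
      \sum_j (('X_i * f') * (c j0 * b (lift j0 j) - b j0 * c (lift j0 j))) *: T j.
    by apply: eq_bigr => j _; rewrite scalerA mulrC.
  rewrite lincomb_sub /F; move: (\sum_(j < n) _) (\sum_(j < n) _) => X Y.
  by apply/rowP => l; rewrite !mxE; ring.
- move=> kap [f E].
  (* Expanding Euler through c turns the given relation into one among the independent S_l. *)
  pose rho l := if unlift j0 l is Some j then 'X_i * f' * kap j - f * c l else - f * c j0.
  have rhoS : \sum_l rho l *: S l = 0.
    rewrite (bigD1_ord j0) //= /rho unlift_none /=.
    rewrite (eq_bigr (fun j => kap j *: (('X_i * f') *: T j) - f *: (c (lift j0 j) *: T j))).
      rewrite sumrB -scaler_sumr.
      rewrite E cE (bigD1_ord j0) //= scalerDr scalerA mulNr scaleNr.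
      by rewrite addrK addNr.
    by move=> j _; rewrite liftK scalerBl !scalerA [kap j * _]mulrC.
  have rho0 := generators_independent A10 Sgen rhoS.
  have f0 : f = 0.
    have /eqP := rho0 j0; rewrite /rho unlift_none mulf_eq0 (negPf (proj_not_neq0 cj0)) orbF.
    by rewrite oppr_eq0 => /eqP.
  move=> j; have /eqP := rho0 (lift j0 j); rewrite /rho liftK f0 mul0r subr0 !mulf_eq0.
  by rewrite (negPf (proj_not_neq0 Xi)) (negPf (proj_not_neq0 f'p)) => /eqP.
Qed.

End Trivialization.

(** * Adding the hyperplanes of one variable *)

Section Interpolation.

Variables (k : closedFieldType) (n : nat) (v : 'I_n.+1).
Local Notation R := {mpoly k[n.+1]}.
Implicit Types (A E : seq 'rV[k]_n.+1) (a b e : 'rV[k]_n.+1) (f g h : R) (theta : 'rV[R]_n.+1).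

(* A Newton interpolation step: modulo [linear_form e] the correction term is
   divisible by the product of the pairwise coprime forms [e' - e]. *)
Lemma interpolation A E theta : uniq E -> (forall e, e \in E -> e 0 v = 1) ->
  (forall e a b, e \in E -> a \in E -> b \in E -> a != e -> b != e ->
     mdvd (linear_form (a - e)) (linear_form (b - e)) -> a = b) ->
  (forall e e', e \in E -> e' \in E -> e != e' ->
     mdvd (linear_form (e' - e)) (pairing theta (e' - e))) ->
  exists h, forall e, e \in E -> mdvd (linear_form e) (pairing theta e + h).
Proof.
elim: E => [|e E IH] /=; first by exists 0.
case/andP => eE uE Ev Edist Ediff.
have memE c : c \in E -> c \in e :: E by rewrite inE => ->; rewrite orbT.
have eneq c : c \in E -> c != e by move=> cE; apply: contraNneq eE => <-.
have e1 := Ev _ (mem_head _ _); have ev0 : e 0 v != 0 by rewrite e1 oner_neq0.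
have [||||h hE] := IH.
- exact: uE.
- by move=> c /memE; exact: Ev.
- by move=> c a b /memE cE /memE aE /memE bE; exact: Edist.
- by move=> c c' /memE cE /memE c'E; exact: Ediff.
have killE c : c \in E -> kill e v (linear_form c) = linear_form (c - e).
  move=> /memE cE; rewrite kill_linear_form e1 (Ev _ cE) divr1 scale1r.
  by rewrite !linear_formE pairingBr.
set X := pairing theta e + h.
have [c' cE'] : mdvd (\prod_(b <- [seq c - e | c <- E]) linear_form b) (kill e v X).
  apply: mdvd_prod.
  - by rewrite map_inj_uniq // => a b /addIr.
  - by move=> _ /mapP[c cE ->]; rewrite subr_eq0 eneq.
  - move=> _ _ /mapP[a aE ->] /mapP[b bE ->] /(Edist e) -> //; rewrite ?mem_head ?memE ?eneq //.
  - move=> _ /mapP[c cE ->].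
    have [q qE] := hE c cE.
    have [g gE] := Ediff e c (mem_head _ _) (memE _ cE) (ltac:(by rewrite eq_sym eneq)).
    have -> : X = q * linear_form c - g * linear_form (c - e).
      by rewrite -qE -gE pairingBr /X; ring.
    rewrite rmorphB !rmorphM /= killE //.
    have -> : kill e v (linear_form (c - e)) = linear_form (c - e).
      by rewrite kill_linear_form !mxE e1 Ev ?memE // subrr mul0r scale0r subr0.
    by rewrite -mulrBl; exists (kill e v q - kill e v g).
rewrite big_map in cE'.
have cE2 : kill e v X = c' * kill e v (\prod_(c <- E) linear_form c).
  by rewrite cE' rmorph_prod; congr (_ * _); rewrite !big_seq; apply: eq_bigr => c cE; rewrite /= killE.
exists (h - c' * \prod_(c <- E) linear_form c) => c; rewrite inE => /orP[/eqP->|cE]; last first.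
  rewrite addrA; apply: mdvdB; first exact: hE.
  by apply: mdvd_mull; rewrite (big_rem c) //=; apply: mdvd_mulr; exact: mdvd_refl.
rewrite addrA -/X.
have -> : X - c' * \prod_(c <- E) linear_form c = (X - kill e v X) -
    c' * (\prod_(c <- E) linear_form c - kill e v (\prod_(c <- E) linear_form c)).
  by rewrite cE2; ring.
by apply: mdvdB; [|apply: mdvd_mull]; exact: kill_congr.
Qed.

(** d/dx_v kills the forms of A, and one of its coordinates c_j0 is a unit at the origin, so it can
    replace B_j0. Interpolation corrects the other B_j along d/dx_v, which is itself multiplied by
    the product of E; the number of generators does not grow. *)
Lemma locally_generated_add A E : (forall a, a \in A -> a 0 v = 0) ->
  uniq E -> (forall e, e \in E -> e 0 v = 1) ->
  (forall e a b, e \in E -> a \in E -> b \in E -> a != e -> b != e ->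
     mdvd (linear_form (a - e)) (linear_form (b - e)) -> a = b) ->
  (forall theta e e', log_der A theta -> e \in E -> e' \in E -> e != e' ->
     mdvd (linear_form (e' - e)) (pairing theta (e' - e))) ->
  locally_generated A (fun=> 0) -> locally_generated (E ++ A) (fun=> 0).
Proof.
move=> Av uE Ev Edist Ediff /locally_generated_ev0[m [B [mn BA Bgen]]].
pose dv : 'rV[R]_n.+1 := delta_mx 0 v.
have dvE e f : pairing (f *: dv) e = e 0 v *: f by exact: pairing_deltal.
have dvA f : log_der A (f *: dv).
  by move=> a aA; rewrite dvE Av // scale0r; exact: mdvd0.
have [g g1 [c cE]] := Bgen (1 *: dv) (dvA 1).
have [j0 cj0] : exists j0, ev0 (c j0) != 0.
  apply: NNPP => h; have := congr1 (fun w : 'rV[R]_n.+1 => ev0 (w 0 v)) cE.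
  rewrite !mxE !eqxx mulr1 mulr1 g1 summxE ev0_sum big1 => [/eqP|j _]; first by rewrite oner_eq0.
  rewrite mxE ev0M; suff -> : ev0 (c j) = 0 by rewrite mul0r.
  by apply/eqP; apply: NNPP => /negP hj; apply: h; exists j.
have hex j : exists h, forall e, e \in E -> mdvd (linear_form e) (pairing (B j) e + h).
  by apply: (@interpolation A) => // e e' eE e'E ee'; exact: Ediff.
have [h hP] := choice_fun hex.
pose G := \prod_(e <- E) linear_form e.
pose B' j := if j == j0 then G *: dv else B j + h j *: dv.
have B'A j : log_der (E ++ A) (B' j).
  move=> a; rewrite mem_cat /B'; case: eqP => _ /orP[aE|aA].
  - rewrite dvE Ev // scale1r /G (big_rem a) //=; apply: mdvd_mulr; exact: mdvd_refl.
  - exact: dvA.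
  - by rewrite pairingDl dvE Ev // scale1r; exact: hP.
  - by rewrite pairingDl; apply: mdvdD; [exact: BA|exact: dvA].
exists m, B'; split=> // theta thE.
have thA : log_der A theta by apply: log_der_sub thE => a; rewrite mem_cat orbC => ->.
have [g' g'1 [b bE]] := Bgen _ thA.
exists (c j0 * g'); first by rewrite -/(ev0 _) ev0M g'1 mulr1.
(* Eliminating B_j0 leaves a multiple [H] of d/dx_v; being logarithmic along E, it is divisible by
   [G]. *)
pose kap j := c j0 * b j - b j0 * c j.
pose H := b j0 * g - \sum_(j | j != j0) kap j * h j.
have thE2 : (c j0 * g') *: theta = \sum_(j | j != j0) kap j *: B' j + H *: dv.
  have -> : \sum_(j | j != j0) kap j *: B' j =
      \sum_(j | j != j0) kap j *: B j + (\sum_(j | j != j0) kap j * h j) *: dv.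
    rewrite scaler_suml -big_split; apply: eq_bigr => j /negPf jj0.
    by rewrite /B' jj0 scalerDr scalerA.
  have -> : \sum_(j | j != j0) kap j *: B j = c j0 *: (g' *: theta) - b j0 *: (g *: (1 *: dv)).
    rewrite bE cE !scaler_sumr -sumrB [RHS](bigD1 j0) //= !scalerA mulrC subrr add0r.
    by apply: eq_bigr => j _; rewrite !scalerA -scalerBl.
  by apply/rowP => l; rewrite !mxE /H; ring.
have HE e : e \in E -> mdvd (linear_form e) H.
  move=> eE; have : log_der (E ++ A) (H *: dv).
    have -> : H *: dv = (c j0 * g') *: theta - \sum_(j | j != j0) kap j *: B' j.
      by rewrite thE2 addrC addKr.
    by apply: log_derB; [exact: log_derZ|apply: log_der_sum => j _; exact: log_derZ].
  by move/(_ e); rewrite mem_cat eE dvE Ev // scale1r; apply.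
rewrite thE2; have [q ->] : exists q, H = q * G.
  apply: mdvd_prod => // [e eE|e e' eE e'E].
    by apply/eqP => e0; have /eqP := Ev _ eE; rewrite e0 mxE eq_sym oner_eq0.
  move/linear_form_mdvd => [|c1 e'E1].
    by apply/eqP => e0; have /eqP := Ev _ eE; rewrite e0 mxE eq_sym oner_eq0.
  have := Ev _ e'E; rewrite e'E1 mxE Ev // mulr1 => c11.
  by rewrite c11 scale1r.
rewrite -scalerA; apply: spanD; last first.
  by apply: spanZ; have := span_mem B' j0; rewrite {2}/B' eqxx.
by apply: span_sum => j _; apply/spanZ/span_mem.
Qed.

End Interpolation.

(** * Simplicial vertices of chordal graphs *)

Section Chordal.

Variables (T : finType) (G : graph T).
Local Notation e := (edge G).
Hypothesis e_sym : ssrbool.symmetric e.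
Hypothesis e_irr : irreflexive e.
Hypothesis chordG : chordal G.

Definition simplicial (S : {set T}) z := forall u w, u \in S -> w \in S ->
  e z u -> e z w -> u != w -> e u w.

Lemma min_seq (P : seq T -> Prop) q0 : P q0 ->
  exists2 q, P q & forall q', P q' -> (size q <= size q')%N.
Proof.
have [m] := ubnP (size q0); elim: m q0 => // m IH q0 qm Pq0.
have [[q Pq qq0]|h] := classic (exists2 q, P q & (size q < size q0)%N).
  by apply: (IH q) Pq; rewrite ltnS in qm; exact: leq_trans qq0 qm.
exists q0 => // q' Pq'; rewrite leqNgt; apply/negP => lt; apply: h; by exists q'.
Qed.

(* A shortest path from [s] to [t] with interior in [C] is induced, so if [s]
   and [t] were not adjacent it would close up through [x] into a chordless
   cycle. *)
Lemma separator_clique (x s t : T) (C : {set T}) q0 :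
  C \subset vertices G -> x \in vertices G -> s \in vertices G -> t \in vertices G ->
  (forall z, z \in C -> ~~ e x z) -> x \notin C -> s \notin C -> t \notin C ->
  e x s -> e x t -> s != t ->
  path e s q0 -> last s q0 = t -> all (fun z => (z \in C) || (z == t)) q0 ->
  e s t.
Proof.
move=> CV xV sV tV Cx xC sC tC xs xt st q0p q0t q0C.
apply/negPn/negP => est.
pose P q := [/\ path e s q, last s q = t & all (fun z => (z \in C) || (z == t)) q].
have [q1 [q1p q1t q1C] q1min] := @min_seq P q0 (And3 q0p q0t q0C).
have [q [qp qt qC uq qmin]] : exists q, [/\ path e s q, last s q = t,
    all (fun z => (z \in C) || (z == t)) q, uniq (s :: q) &
    forall q', P q' -> (size q <= size q')%N].
  move: q1t; case/shortenP: q1p => q qp uq qsub qt; exists q; split=> //.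
    by apply/allP => z /qsub; exact: (allP q1C).
  move=> q' /q1min; apply: leq_trans.
  by have /andP[_ uq'] := uq; exact: uniq_leq_size.
have size_q : (2 <= size q)%N.
  case: q qt qp {qC uq qmin} => [|a [|b q]] //=; first by move=> /eqP; rewrite (negPf st).
  by move=> ->; rewrite andbT (negPf est).
have xq : x \notin s :: q.
  rewrite inE negb_or; apply/andP; split; first by apply: contraTneq xs => <-; rewrite e_irr.
  apply/negP => /(allP qC)/orP[xC'|/eqP xt']; first by rewrite xC' in xC.
  by rewrite xt' e_irr in xt.
have [|||a [b [ac bc eab ba ab]]] := chordG (c := x :: s :: q).
- move=> z; rewrite !inE => /or3P[/eqP->//|/eqP->//|/(allP qC)/orP[/(subsetP CV)//|/eqP->//]].
- apply/andP; split; last by rewrite /= xq; move: uq => /= ->.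
  by rewrite /= xs rcons_path qp qt e_sym xt.
- by rewrite /= !ltnS.
have tq : t \in q by rewrite -qt; case: (q) size_q => //= z q' _; exact: mem_last.
have x_nbr z : z \in x :: s :: q -> e x z -> z = s \/ z = t.
  rewrite !inE => /or3P[/eqP->|/eqP->|/(allP qC)/orP[/Cx/negPf->//|/eqP->]]; first by rewrite e_irr.
  - by left.
  - by right.
have nextE z : z \in s :: q -> next (x :: s :: q) z = nth x (s :: q) (index z (s :: q)).+1.
  move=> zq; have /negPf xz : x != z by apply: contraNneq xq => ->.
  by rewrite next_nth inE zq orbT /= xz.
have next_t : next (x :: s :: q) t = x.
  rewrite nextE ?inE ?tq ?orbT // -qt index_last //.
  by rewrite nth_default.
have next_x : next (x :: s :: q) x = s by rewrite /= eqxx.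
have chord_x z : z \in x :: s :: q -> e x z -> z != next (x :: s :: q) x -> x != next (x :: s :: q) z -> False.
  move=> zc xz; rewrite next_x; have [->|->] := x_nbr _ zc xz; first by rewrite eqxx.
  by move=> _; rewrite next_t eqxx.
have [ax|ax] := eqVneq a x; first by rewrite ax in eab ba ab; exact: (chord_x b).
have [bx|bx] := eqVneq b x; first by rewrite bx e_sym in eab; rewrite bx in ba ab; exact: (chord_x a).
have aq : a \in s :: q by move: ac; rewrite inE (negPf ax).
have bq : b \in s :: q by move: bc; rewrite inE (negPf bx).
(* A chord from c to d gives a shortcut, against minimality. Positions are counted in [s :: q], so
   the prefix ending at c is [take i q] and the suffix starting at d is [drop j.-1 q]. *)
have short c d : c \in s :: q -> d \in s :: q -> e c d -> d != next (x :: s :: q) c ->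
    (index c (s :: q) < index d (s :: q))%N -> False.
  move=> cq dq cd; rewrite (nextE _ cq); set i := index c _; set j := index d _ => dn ij.
  have ij1 : (i.+1 < j)%N.
    by rewrite ltn_neqAle ij andbT; apply: contraNneq dn => ->; rewrite nth_index.
  have jq : (j <= size q)%N by rewrite -ltnS -[(size q).+1]/(size (s :: q)) index_mem.
  have iq : (i <= size q)%N by exact: leq_trans (ltnW ij) jq.
  have dE : drop j.-1 q = d :: drop j q.
    have j0 : (0 < j)%N by exact: leq_ltn_trans (leq0n _) ij1.
    rewrite (drop_nth x) ?prednK //; congr (_ :: _).
    by rewrite -[RHS](nth_index x dq) -/j -{2}(prednK j0).
  have cE : last s (take i q) = c.
    rewrite (last_nth x) size_takel // -[s :: take i q]/(take i.+1 (s :: q)).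
    by rewrite nth_take // nth_index.
  have : P (take i q ++ drop j.-1 q).
    split.
    - rewrite cat_path cE dE /= cd.
      have := qp; rewrite -{1}(cat_take_drop i q) cat_path => /andP[-> _] /=.
      by have := qp; rewrite -{1}(cat_take_drop j.-1 q) dE cat_path => /andP[_ /= /andP[]].
    - rewrite last_cat; have := qt; rewrite -{1}(cat_take_drop j.-1 q) last_cat.
      by rewrite dE.
    - apply/allP => z; rewrite mem_cat => /orP[/mem_take|/mem_drop]; exact: (allP qC).
  move/qmin; rewrite size_cat size_takel // size_drop leqNgt => /negP; apply.
  have j1q : (j.-1 <= size q)%N by exact: leq_trans (leq_pred _) jq.
  rewrite -{2}(subnKC j1q) ltn_add2r.
  by rewrite -ltnS prednK // (leq_ltn_trans _ ij1).
have [lt|gt|eq] := ltngtP (index a (s :: q)) (index b (s :: q)).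
- exact: (short a b).
- by apply: (short b a) => //; rewrite e_sym.
- by move: eab; rewrite -(nth_index x aq) eq (nth_index x bq) e_irr.
Qed.

(* For a component [C] of the complement of the closed neighbourhood of [x],
   the set [B] of its outer neighbours is a clique by the previous lemma, so
   induction on [C :|: B] yields a simplicial vertex inside [C]. *)
Lemma simplicial_avoiding m (S : {set T}) x y : (#|S| <= m)%N -> S \subset vertices G ->
  x \in S -> y \in S -> y != x -> ~~ e x y ->
  exists z, [/\ z \in S, z != x, ~~ e x z & simplicial S z].
Proof.
elim: m S x y => [|m IH] S x y Sm SV xS yS yx exy.
  by move: Sm xS; rewrite leqn0 cards_eq0 => /eqP ->; rewrite inE.
pose D := [set z in S | (z != x) && ~~ e x z].
have yD : y \in D by rewrite inE yS yx exy.
pose r a b := [&& a \in D, b \in D & e a b].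
have r_sym : connect_sym r by apply: sym_connect_sym => a b; rewrite /r e_sym andbCA.
pose C := [set z | connect r y z].
have yC : y \in C by rewrite inE connect0.
have CD z : z \in C -> z \in D.
  rewrite inE => /connectP[p rp ->]; elim: p y yD rp {yS yx exy C yC} => //= a p IHp y' _.
  by case/andP => /and3P[_ aD _] /IHp; apply.
have CS z : z \in C -> z \in S by move/CD; rewrite inE => /andP[].
have Cx z : z \in C -> ~~ e x z by move/CD; rewrite inE => /and3P[].
have xC : x \notin C by apply/negP => /CD; rewrite inE eqxx andbF.
pose B := [set s in S | (s \notin C) && [exists c in C, e s c]].
have BP s : s \in B -> [/\ s \in S, s \notin C & exists2 c, c \in C & e s c].
  rewrite inE => /and3P[sS sC /existsP[c /andP[cC sc]]]; split=> //; by exists c.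
have Bx s : s \in B -> e x s.
  case/BP => sS sC [c cC sc]; apply: contraNT sC => xs; rewrite inE.
  have sx : s != x by apply: contraTneq sc => ->; exact: Cx.
  have yc : connect r y c by move: cC; rewrite inE.
  by apply: (connect_trans yc); apply: connect1; rewrite /r CD // inE sS sx xs e_sym sc.
have Bclique s t : s \in B -> t \in B -> s != t -> e s t.
  move=> sB tB st; have [sS sC [c cC sc]] := BP _ sB; have [tS tC [d dC td]] := BP _ tB.
  have /connectP[p rp dE] : connect r c d.
    by apply: (@connect_trans _ _ y); [rewrite r_sym|]; move: cC dC; rewrite !inE.
  have pC a : a \in c :: p -> a \in C.
    move=> ap; rewrite inE; apply: (@connect_trans _ _ c); first by move: cC; rewrite inE.
    exact: path_connect rp _ ap.
  apply: (@separator_clique x s t C (c :: rcons p t)) => //.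
  - by apply/subsetP => a /CS; exact: (subsetP SV).
  - exact: (subsetP SV).
  - exact: (subsetP SV).
  - exact: (subsetP SV).
  - exact: Bx.
  - exact: Bx.
  - rewrite /= sc rcons_path -dE e_sym td andbT /=.
    by apply: sub_path rp => a b /and3P[].
  - by rewrite /= last_rcons.
  - apply/allP => a; rewrite -rcons_cons mem_rcons inE => /orP[/eqP->|/pC->//].
    by rewrite eqxx orbT.
pose S' := C :|: B.
have S'S : S' \subset S.
  by apply/subsetP => a; rewrite inE => /orP[/CS//|/BP[]].
have xS' : x \notin S'.
  by rewrite inE (negPf xC) /=; apply/negP => /Bx; rewrite e_irr.
have S'm : (#|S'| <= m)%N.
  rewrite -ltnS; apply: leq_trans Sm; apply: proper_card; rewrite properE S'S.
  by apply: contraNN xS' => /subsetP; apply.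
have S'V := subset_trans S'S SV.
have [z zC zS'] : exists2 z, z \in C & simplicial S' z.
  (* A simplicial vertex found away from y' in the clique B is not adjacent to y', so it lies
     outside B, that is, in C. *)
  have [[y' [w [y'B wS' wy' y'w]]]|hB] := classic (exists y' w,
      [/\ y' \in B, w \in S', w != y' & ~~ e y' w]).
    have [|z [zS' zy' y'z simz]] := IH S' y' w S'm S'V _ wS' wy' y'w.
      by rewrite inE y'B orbT.
    exists z => //; move: zS'; rewrite inE => /orP[//|zB].
    by move: y'z; rewrite Bclique //; rewrite eq_sym.
  have B_all y' w : y' \in B -> w \in S' -> w != y' -> e y' w.
    by move=> y'B wS' wy'; apply/negPn/negP => h; apply: hB; exists y', w.
  have [[y' [w [y'C wS' wy' y'w]]]|hC] := classic (exists y' w,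
      [/\ y' \in C, w \in S', w != y' & ~~ e y' w]).
    have [|z [zS' zy' y'z simz]] := IH S' y' w S'm S'V _ wS' wy' y'w.
      by rewrite inE y'C.
    exists z => //; move: zS'; rewrite inE => /orP[//|zB].
    have y'S' : y' \in S' by rewrite inE y'C.
    by move: y'z; rewrite e_sym (B_all z y' zB y'S') // eq_sym.
  exists y => // u w uS' wS' _ _ uw; move: (uS'); rewrite inE => /orP[uC|uB].
    by apply/negPn/negP => h; apply: hC; exists u, w; rewrite eq_sym.
  by apply: B_all => //; rewrite eq_sym.
exists z; split.
- exact: CS.
- by apply: contraNneq xC => <-.
- exact: Cx.
have nbr u : u \in S -> e z u -> u \in S'.
  move=> uS zu; rewrite inE; have [//|uC] /= := boolP (u \in C).
  by rewrite inE uS uC; apply/existsP; exists z; rewrite zC e_sym.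
by move=> u w uS wS zu zw; apply: zS' => //; exact: nbr.
Qed.

(** Two nonadjacent vertices feed the previous lemma; in a clique every vertex is simplicial. *)
Lemma simplicial_exists (S : {set T}) : S \subset vertices G -> S != set0 ->
  exists2 z, z \in S & simplicial S z.
Proof.
move=> SV /set0Pn[x0 x0S].
have [[x [y [xS yS yx exy]]]|h] := classic (exists x y, [/\ x \in S, y \in S, y != x & ~~ e x y]).
  by have [z [zS _ _ simz]] := simplicial_avoiding (leqnn _) SV xS yS yx exy; exists z.
exists x0 => // u w uS wS _ _ uw; apply/negPn/negP => nuw.
by apply: h; exists u, w; rewrite eq_sym.
Qed.

End Chordal.

(** * Chordless cycles *)

Section ChordlessCycle.

Variables (k : closedFieldType) (n : nat).
Local Notation R := {mpoly k[n.+1]}.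
Variables (c : seq 'I_n.+1) (alpha : 'I_n.+1 -> k).
Hypothesis uc : uniq c.
Hypothesis size_c : (4 <= size c)%N.
Hypothesis alpha0 : forall i, i \in c -> alpha i != 0.
Local Notation nx := (next c).

Lemma iter_next_neq i j : i \in c -> (0 < j < 4)%N -> iter j nx i != i.
Proof.
move=> ic /andP[j0 j4]; have cyc := cycle_next uc.
have ord : order nx i = size c by rewrite (order_cycle cyc).
apply/eqP => E; have := @findex_iter _ nx i j.
by rewrite ord E findex0 (leq_trans j4 size_c) => /(_ isT) j00; rewrite -j00 in j0.
Qed.

Lemma next_ind (P : 'I_n.+1 -> Prop) i0 : i0 \in c -> P i0 ->
  (forall i, i \in c -> P i -> P (nx i)) -> forall i, i \in c -> P i.
Proof.
move=> i0c P0 PS i ic; have cyc := cycle_next uc.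
have : fconnect nx i0 i by rewrite (fconnect_cycle cyc).
move/iter_findex <-; elim: findex => // j IH /=; apply: PS => //.
by elim: j {IH} => //= j IH; rewrite mem_next.
Qed.

(** In the application alpha inverts the coordinates of a general point of the flat. The forms sum
    to zero around the cycle, which is the source of [cycle_const]. *)
Definition cycle_form i : 'rV[k]_n.+1 := alpha i *: delta_mx 0 i - alpha (nx i) *: delta_mx 0 (nx i).

Local Notation y i := (linear_form (cycle_form i) : R).

Lemma cycle_formE i j : cycle_form i 0 j = alpha i *+ (j == i) - alpha (nx i) *+ (j == nx i).
Proof. by rewrite !mxE !eqxx /= !mulr_natr. Qed.

Lemma pairing_cycle_form (theta : 'rV[R]_n.+1) i :
  pairing theta (cycle_form i) = alpha i *: theta 0 i - alpha (nx i) *: theta 0 (nx i).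
Proof. by rewrite pairingBr !pairingZr !pairing_delta. Qed.

Lemma cycle_form_neq0 i : i \in c -> y i != 0.
Proof.
move=> ic; rewrite linear_form_eq0; apply: contraNneq (alpha0 ic) => /rowP/(_ i).
have := @iter_next_neq i 1 ic isT; rewrite /= cycle_formE mxE eqxx eq_sym => /negPf ->.
by rewrite subr0 => /eqP.
Qed.

Variable i0 : 'I_n.+1.
Hypothesis i0c : i0 \in c.

(* Constant derivations off the cycle, the translation [w i0] along the line
   where all [alpha_i x_i] agree, the multiples [wE] of Euler, and, at each other
   vertex of the cycle, the product of the forms of its two edges. *)
Definition cycle_der (w : 'I_n.+1 -> R) (wE : R) : 'rV[R]_n.+1 :=
  wE *: euler k n + \row_i (if i \in c then
    (alpha i)^-1 *: (w i0 + (if i == i0 then 0 else w i) * (y (prev c i) * y i)) else w i).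

Definition omega (w : 'I_n.+1 -> R) i := if i == i0 then 0 else w i.

(** The translation cancels on every edge, and each end vertex of the edge contributes to the
    cofactor the form of its other edge; hence the cofactor has degree at most 1 when the parameters
    are constants. *)
Lemma pairing_cycle_der w wE i : i \in c ->
  pairing (cycle_der w wE) (cycle_form i) =
  (wE + omega w i * y (prev c i) - omega w (nx i) * y (nx i)) * y i.
Proof.
move=> ic; have nc : nx i \in c by rewrite mem_next.
rewrite pairingDl pairingZl -linear_formE pairing_cycle_form !mxE ic nc.
have scaleVK j f : j \in c -> alpha j *: ((alpha j)^-1 *: f) = f :> R.
  by move=> /alpha0 aj; rewrite scalerA divff // scale1r.
rewrite (scaleVK _ _ ic) (scaleVK _ _ nc) (prev_next uc) -/(omega w i) -/(omega w (nx i)).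
have alg (q r s t f g h : R) :
    q * f + (r + s * (g * f) - (r + t * (f * h))) = (q + s * g - t * h) * f by ring.
exact: alg.
Qed.

Variable A : seq 'rV[k]_n.+1.
Hypothesis AP : forall theta, log_der A theta <->
  forall i, i \in c -> mdvd (y i) (pairing theta (cycle_form i)).

Lemma log_der_cycle w wE : log_der A (cycle_der w wE).
Proof.
apply/AP => i ic; rewrite pairing_cycle_der //; apply: mdvd_mull; exact: mdvd_refl.
Qed.

Definition ev1 l (f : R) : k := ev0 f^`M(l).

Lemma pairing_sumr (theta : 'rV[R]_n.+1) (I : finType) (P : pred I) (F : I -> 'rV[k]_n.+1) :
  pairing theta (\sum_(i | P i) F i) = \sum_(i | P i) pairing theta (F i).
Proof.
apply: (big_morph (pairing theta)) => [a b|]; first exact: pairingDr.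
by rewrite -(scale0r 0) pairingZr scale0r.
Qed.

Lemma ev1M l f g : ev1 l (f * g) = ev1 l f * ev0 g + ev0 f * ev1 l g.
Proof. by rewrite /ev1 mderivM ev0D !ev0M. Qed.

Lemma ev1D l f g : ev1 l (f + g) = ev1 l f + ev1 l g.
Proof. by rewrite /ev1 mderivD ev0D. Qed.

Lemma ev1B l f g : ev1 l (f - g) = ev1 l f - ev1 l g.
Proof. by rewrite /ev1 mderivB ev0B. Qed.

Lemma ev1C l a : ev1 l a%:MP = 0.
Proof. by rewrite /ev1 mderivC; exact: meval0. Qed.

Lemma ev1_linear_form l a : ev1 l (linear_form a) = a 0 l.
Proof. by rewrite /ev1 mderiv_linear_form ev0C. Qed.

Lemma ev0_affine_form (a b d : k) (f g : 'rV[k]_n.+1) :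
  ev0 (a%:MP + b%:MP * linear_form f - d%:MP * linear_form g) = a.
Proof.
rewrite ev0B ev0D (ev0M _ (linear_form f)) (ev0M _ (linear_form g)) !ev0_linear_form.
by rewrite !mulr0 subr0 addr0 ev0C.
Qed.

Lemma ev1_affine_form l (a b d : k) (f g : 'rV[k]_n.+1) :
  ev1 l (a%:MP + b%:MP * linear_form f - d%:MP * linear_form g) = b * f 0 l - d * g 0 l.
Proof.
rewrite ev1B ev1D (ev1M _ _ (linear_form f)) (ev1M _ _ (linear_form g)) !ev0_linear_form.
by rewrite !mulr0 !add0r !ev1_linear_form ev1C !ev0C add0r.
Qed.

Lemma ev1_sum l (I : finType) (P : pred I) (F : I -> R) :
  ev1 l (\sum_(i | P i) F i) = \sum_(i | P i) ev1 l (F i).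
Proof. by rewrite /ev1 -ev0_sum; congr ev0; exact: raddf_sum. Qed.

(* For a logarithmic derivation [H] with [H(y_i) = beta_i y_i], the linear part
   of [sum_i H(y_i) = 0] shows that all [beta_i] have the same constant term. *)
Lemma cycle_const (H : 'rV[R]_n.+1) (beta : 'I_n.+1 -> R) :
  (forall i, i \in c -> pairing H (cycle_form i) = beta i * y i) ->
  forall i, i \in c -> ev0 (beta (nx i)) = ev0 (beta i).
Proof.
move=> HE i ic; have nc : nx i \in c by rewrite mem_next.
have sum0 : \sum_(j in c) cycle_form j = 0.
  rewrite sumrB [X in _ - X](_ : _ = \sum_(j in c) alpha j *: delta_mx 0 j) ?subrr //.
  rewrite [RHS](reindex_onto nx (prev c)) => [|j jc]; last exact: next_prev.
  by apply: eq_big => j //; rewrite mem_next prev_next // eqxx andbT.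
have : ev1 (nx i) (\sum_(j in c) pairing H (cycle_form j)) = 0.
  by rewrite -pairing_sumr sum0 -(scale0r 0) pairingZr scale0r -mpolyC0 ev1C.
rewrite ev1_sum; under eq_bigr => j jc do
  rewrite HE // ev1M ev0_linear_form mulr0 add0r ev1_linear_form cycle_formE.
have ni : i != nx i by rewrite eq_sym; exact: (@iter_next_neq i 1).
have nni : (nx i == nx (nx i)) = false.
  by apply/negbTE; rewrite eq_sym; exact: (@iter_next_neq (nx i) 1).
rewrite (bigD1 (nx i)) //= (bigD1 i) /=; last by rewrite ic.
rewrite big1 => [|j /andP[/andP[jc jn] ji]]; last first.
  rewrite eq_sym (negPf jn) (can_eq (prev_next uc)) eq_sym (negPf ji).
  by rewrite subrr mulr0.
rewrite eqxx nni [nx i == i]eq_sym (negPf ni) !mulr0n !mulr1n subr0 sub0r addr0.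
move/eqP; rewrite mulrN -mulrBl mulf_eq0 (negPf (alpha0 nc)) orbF subr_eq0.
by move/eqP.
Qed.

Lemma sum_delta (f : 'I_n.+1 -> R) i : \sum_j f j * (i == j)%:R = f i.
Proof.
rewrite (bigD1 i) //= eqxx mulr1 big1 ?addr0 // => j ji.
by rewrite eq_sym (negPf ji) mulr0.
Qed.

Lemma cycle_der_sum (w : 'I_n.+1 -> R) wE :
  cycle_der w wE = wE *: cycle_der (fun=> 0) 1 +
    \sum_j w j *: cycle_der (fun i => (i == j)%:R) 0.
Proof.
apply/rowP => i; rewrite !mxE summxE.
under eq_bigr do rewrite !mxE mul0r add0r.
case: ifP => ic; last by rewrite sum_delta; ring.
under eq_bigr do rewrite -scalerAr mulrDr.
rewrite -scaler_sumr big_split sum_delta /=.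
have [->|ii0] := eqVneq i i0.
  rewrite big1 => [|j _]; last by rewrite mul0r mulr0.
  by rewrite !mul0r !addr0 scaler0; ring.
under eq_bigr do rewrite mulrCA mulrA [_ * w _]mulrC.
rewrite -mulr_suml sum_delta mul0r addr0 scaler0; ring.
Qed.

(* The [n.+2] derivations [cycle_der] are independent modulo the variables
   times Der(-log A), whereas a free module of rank [n.+1] has no more than
   [n.+1] such elements. *)
Lemma cycle_not_free : ~ locally_generated A (fun=> 0).
Proof.
move/homog_basis_exists => [H [_ [HA _ Hgen]]].
pose e (l : 'I_n.+2) := if unlift ord0 l is Some j
  then cycle_der (fun i => (i == j)%:R) 0 else cycle_der (fun=> 0) 1.
have eA l : log_der A (e l) by rewrite /e; case: unlift => [j|]; exact: log_der_cycle.
have [C CE] := choice_fun (fun l => Hgen _ (eA l)).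
(* The combination [Theta] of the n+2 derivations with weights w has coordinates [g s] without
   constant term in the basis H; all weights are then shown to vanish. *)
have [w w0 wC] : exists2 w : 'rV[k]_n.+2, w != 0 &
    w *m (\matrix_(l < n.+2, s < n.+1) ev0 (C l s)) = 0 by exact: kernel_vector.
pose om i : k := w 0 (lift ord0 i); pose omk i : k := if i == i0 then 0 else om i.
pose Theta := cycle_der (fun i => (om i)%:MP) (w 0 ord0)%:MP.
pose g s := \sum_l (w 0 l)%:MP * C l s.
have ThetaE : Theta = \sum_s g s *: H s.
  have -> : Theta = \sum_l (w 0 l)%:MP *: e l.
    rewrite /Theta cycle_der_sum [RHS]big_ord_recl /e unlift_none; congr (_ + _).
    by apply: eq_bigr => j _; rewrite liftK.
  under eq_bigr do rewrite CE scaler_sumr.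
  rewrite exchange_big; apply: eq_bigr => s _ /=.
  by rewrite scaler_suml; apply: eq_bigr => l _; rewrite scalerA.
have g0 s : ev0 (g s) = 0.
  rewrite ev0_sum; have := congr1 (fun u : 'rV_n.+1 => u 0 s) wC; rewrite !mxE => vs.
  by rewrite -[RHS]vs; apply: eq_bigr => l _; rewrite ev0M ev0C mxE.
have bex s i : exists b, i \in c -> pairing (H s) (cycle_form i) = b * y i.
  have [ic|_] := boolP (i \in c); last by exists 0.
  by have [b bE] := proj1 (AP _) (HA s) i ic; exists b.
have [beta betaE] := choice_fun (fun s => choice_fun (bex s)).
have omegaE i : omega (fun i => (om i)%:MP) i = (omk i)%:MP.
  by rewrite /omega /omk; case: ifP => // _; rewrite mpolyC0.
have QE i : i \in c -> (w 0 ord0)%:MP + (omk i)%:MP * y (prev c i) -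
    (omk (nx i))%:MP * y (nx i) = \sum_s g s * beta s i.
  move=> ic; apply: (mulIf (cycle_form_neq0 ic)); rewrite -!omegaE -pairing_cycle_der //.
  rewrite -/Theta ThetaE pairing_suml mulr_suml; apply: eq_bigr => s _.
  by rewrite pairingZl betaE // mulrA.
have wE0 : w 0 ord0 = 0.
  have := congr1 (@ev0 k n) (QE _ i0c).
  rewrite ev0_sum big1 => [|s _]; last by rewrite ev0M g0 mul0r.
  by rewrite ev0_affine_form.
(* Linear parts: as g_s has no constant term, only the constant term of beta_s contributes. *)
have Q1 l i : i \in c -> omk i * cycle_form (prev c i) 0 l -
    omk (nx i) * cycle_form (nx i) 0 l = \sum_s ev1 l (g s) * ev0 (beta s i).
  move=> ic; have := congr1 (ev1 l) (QE _ ic).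
  rewrite ev1_sum ev1_affine_form => ->.
  by apply: eq_bigr => s _; rewrite ev1M g0 mul0r addr0.
(* The right-hand sides for the edges at i and at its successor agree by [cycle_const]. Compare
   coefficients of x_i: since the length is at least 4, the form at the second successor does not
   involve x_i. The alternating values vanish because [omk i0] does. *)
have omk_next i : i \in c -> omk (nx i) = - omk i.
  move=> ic; have nc : nx i \in c by rewrite mem_next.
  have neq j : (0 < j < 4)%N -> (i == iter j nx i) = false.
    by move=> j4; rewrite eq_sym; apply/negbTE; exact: iter_next_neq.
  have := Q1 i (nx i) nc.
  have -> : \sum_s ev1 i (g s) * ev0 (beta s (nx i)) = \sum_s ev1 i (g s) * ev0 (beta s i).
    by apply: eq_bigr => s _; rewrite (cycle_const (betaE s)).
  rewrite -Q1 // prev_next // !cycle_formE eqxx next_prev //.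
  have := neq 1 isT; have := neq 2 isT; have := neq 3 isT; rewrite /= => -> -> ->.
  have -> : (i == prev c i) = false.
    by rewrite -(inj_eq (can_inj (prev_next uc))) next_prev // eq_sym; exact: (neq 1).
  rewrite eqxx !mulr0n !mulr1n !subr0 sub0r !mulr0 !subr0 mulrN -mulNr.
  by move/(mulIf (alpha0 ic)).
have omk0 i : i \in c -> omk i = 0.
  move: i; apply: (@next_ind _ i0) => // [|i ic]; first by rewrite /omk eqxx.
  by rewrite (omk_next _ ic) => ->; rewrite oppr0.
(* The parameters still unknown, at i0 and off the cycle, are read off from the value of [Theta] at
   the origin. *)
have Theta0 i : ev0 (Theta 0 i) = 0.
  rewrite ThetaE summxE ev0_sum big1 // => s _.
  by rewrite mxE ev0M g0 mul0r.
have om0 i : om i = 0.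
  have := Theta0 i; rewrite !mxE wE0 mpolyC0 mul0r add0r.
  have [->|ii0] := eqVneq i i0.
    rewrite i0c mul0r addr0 ev0Z ev0C => /eqP.
    by rewrite mulf_eq0 invr_eq0 (negPf (alpha0 i0c)) => /eqP.
  case: ifP => [ic _|_]; last by rewrite ev0C.
  by have := omk0 _ ic; rewrite /omk (negPf ii0).
case/eqP: w0; apply/rowP => l; rewrite mxE.
by case: (unliftP ord0 l) => [j|] -> //; exact: om0.
Qed.

End ChordlessCycle.

(** * Flats of hypertetrahedral arrangements *)

Section Flats.

Variables (k : closedFieldType) (n : nat).
Local Notation R := {mpoly k[n.+1]}.
Implicit Types (A B : seq 'rV[k]_n.+1) (a b x : 'rV[k]_n.+1) (X : {vspace 'rV[k]_n.+1}).

Lemma memv_bigcap (I : finType) (P : pred I) (V : I -> {vspace 'rV[k]_n.+1}) x :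
  reflect (forall i, P i -> x \in V i) (x \in \bigcap_(i | P i) V i)%VS.
Proof.
rewrite memvE; apply: (iffP subv_bigcapP) => h i /h; by rewrite memvE.
Qed.

Lemma memv_bigcap_seq B x :
  reflect (forall b, b \in B -> x \in hyperplane b) (x \in \bigcap_(b <- B) hyperplane b)%VS.
Proof.
elim: B => [|b B IH]; first by rewrite big_nil memvf; apply: ReflectT.
rewrite big_cons memv_cap; apply: (iffP andP) => [[xb /IH xB] c|h].
  by rewrite inE => /orP[/eqP->|/xB].
split; first by apply: h; exact: mem_head.
by apply/IH => c cB; apply: h; rewrite inE cB orbT.
Qed.

Lemma mem_hyperplane_delta x i : (x \in hyperplane (delta_mx 0 i)) = (x 0 i == 0).
Proof.
rewrite mem_hyperplane (bigD1 i) //= mxE !eqxx mulr1 big1 ?addr0 // => j ji.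
by rewrite mxE eqxx (negPf ji) mulr0.
Qed.

Lemma delta_mem_hyperplane a i : (delta_mx 0 i \in hyperplane a) = (a 0 i == 0).
Proof.
rewrite mem_hyperplane (bigD1 i) //= mxE !eqxx mul1r big1 ?addr0 // => j ji.
by rewrite mxE eqxx (negPf ji) mul0r.
Qed.

Lemma meval_hyperplane a x : ((linear_form a).@[fun i => x 0 i] == 0) = (x \in hyperplane a).
Proof.
by rewrite meval_linear_form mem_hyperplane; under eq_bigr do rewrite mulrC.
Qed.

(** A form vanishing on the common zeros of linear forms is a linear combination of them. *)
Lemma linear_form_dual (p : proj_point k n) B a : (forall b, b \in B -> p (linear_form b)) ->
  (\bigcap_(b <- B) hyperplane b <= hyperplane a)%VS -> p (linear_form a).
Proof.
move=> pB /subvP Ba; pose M := \matrix_(i < size B) nth 0 B i.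
have /submxP[D ->] : (a <= M)%MS.
  rewrite submxE; apply/eqP/rowP => j; rewrite !mxE.
  have : (col j (cokermx M))^T \in hyperplane a.
    apply/Ba/memv_bigcap_seq => b /(nthP 0)[i iB <-].
    rewrite mem_hyperplane; have /matrixP/(_ (Ordinal iB) j) := mulmx_coker M.
    rewrite !mxE => E; rewrite -[X in _ == X]E; apply/eqP; apply: eq_bigr => l _.
    by rewrite !mxE mulrC.
  rewrite mem_hyperplane => /eqP E; rewrite -[RHS]E; apply: eq_bigr => l _.
  by rewrite !mxE mulrC.
rewrite mulmx_sum_row linear_formE pairing_sumr; apply: proj_sum => i.
rewrite pairingZr; apply: proj_scale; rewrite -linear_formE rowK.
by apply: pB; exact: mem_nth.
Qed.

End Flats.

Section Hypertetrahedral.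

Variables (k : closedFieldType) (n : nat) (A : seq 'rV[k]_n.+1).
Local Notation R := {mpoly k[n.+1]}.
Implicit Types (a b x : 'rV[k]_n.+1) (X : {vspace 'rV[k]_n.+1}).

Hypothesis char0 : [pchar k] =i pred0.
Hypothesis arrA : arrangement A.
Hypothesis hyperA : forall a, a \in A ->
    exists i j : 'I_n.+1, (i < j)%N /\ (coord_codim2 k i j <= hyperplane a)%VS.

(** The coordinate vectors other than the i-th and j-th lie in x_i = x_j = 0, so [a] has no further
    coordinates. A coordinate hyperplane is covered with second coefficient zero. *)
Lemma two_coords a l : a \in A -> a 0 l != 0 ->
  exists2 j, j != l & a = a 0 l *: delta_mx 0 l + a 0 j *: delta_mx 0 j.
Proof.
move=> /hyperA[i [j [ij /subvP ija]]] al.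
have a0 m : m != i -> m != j -> a 0 m = 0.
  move=> mi mj; apply/eqP; rewrite -delta_mem_hyperplane; apply: ija.
  rewrite memv_cap !mem_hyperplane_delta !mxE ![_ == m]eq_sym.
  by rewrite (negPf mi) (negPf mj) !andbF eqxx.
have {}ij : i != j by rewrite neq_ltn ij.
have main i' j' : i' != j' -> (forall m, m != i' -> m != j' -> a 0 m = 0) ->
    a = a 0 i' *: delta_mx 0 i' + a 0 j' *: delta_mx 0 j'.
  move=> ij' a0'; apply/rowP => m; rewrite !mxE !eqxx /=.
  have [->|mi] := eqVneq m i'; first by rewrite (negPf ij') mulr1 mulr0 addr0.
  have [->|mj] := eqVneq m j'; first by rewrite mulr1 mulr0 add0r.
  by rewrite !mulr0 addr0 a0'.
have [li|li] := eqVneq l i.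
  by exists j; rewrite li ?[j == i]eq_sym //; exact: main.
have [lj|lj] := eqVneq l j; last by rewrite a0 ?eqxx in al.
exists i; first by rewrite lj.
by rewrite lj; apply: main; rewrite 1?eq_sym // => m mj mi; exact: a0.
Qed.

Lemma mem_two_coords a x l j : a = a 0 l *: delta_mx 0 l + a 0 j *: delta_mx 0 j -> j != l ->
  (x \in hyperplane a) = (x 0 l * a 0 l + x 0 j * a 0 j == 0).
Proof.
move=> aE jl; rewrite mem_hyperplane (bigD1 l) // (bigD1 j) //= big1 ?addr0 // => m /andP[ml mj].
by rewrite aE !mxE !eqxx (negPf ml) (negPf mj) !mulr0 addr0 mulr0.
Qed.

Section Flat.

Variable X : {vspace 'rV[k]_n.+1}.
Local Notation inC i := (X <= coord_hyperplane k i)%VS.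

Lemma inCP i x : inC i -> x \in X -> x 0 i = 0.
Proof. by move=> /subvP h /h; rewrite mem_hyperplane_delta => /eqP. Qed.

(** One criterion covers both branches of the definition: if no coordinate hyperplane contains X, it
    would force the zero form, which is not in A. *)
Lemma mem_localization_W a : a \in localization_W A X <->
  a \in A /\ (forall i, ~~ inC i -> a 0 i = 0).
Proof.
rewrite /localization_W; case: existsP => [_|nC]; last first.
  split=> // -[aA a0]; have /eqP := arrangement_neq0 arrA aA; case; apply/rowP => i.
  by rewrite mxE a0 //; apply/negP => h; apply: nC; exists i.
rewrite mem_filter; split=> [/andP[/subvP Wa aA]|[aA a0]].
  split=> // i iC; apply/eqP; rewrite -delta_mem_hyperplane; apply: Wa.
  apply/memv_bigcap => j jC; rewrite mem_hyperplane_delta mxE eqxx.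
  by case: (eqVneq j i) => [ji|_]; [rewrite -ji jC in iC|rewrite andbF].
rewrite aA andbT; apply/subvP => x /memv_bigcap xW; rewrite mem_hyperplane big1 // => i _.
have [iC|/a0->] := boolP (inC i); last by rewrite mulr0.
by have := xW i iC; rewrite mem_hyperplane_delta => /eqP ->; rewrite mul0r.
Qed.

Lemma generic_flat_point : exists2 x, x \in X & forall i, ~~ inC i -> x 0 i != 0.
Proof.
have [||b|x xX xb] := @generic_point k n char0 (fun x => x \in X)
    [seq delta_mx 0 i | i <- enum 'I_n.+1 & ~~ inC i].
- by move=> x y t xX yX; rewrite memvD ?memvZ.
- by exists 0; exact: mem0v.
- by case/mapP => i; rewrite mem_filter => /andP[/subvPn[y yX yi] _] ->; exists y.
exists x => // i iC; rewrite -mem_hyperplane_delta; apply: xb.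
by apply: map_f; rewrite mem_filter iC mem_enum.
Qed.

Variable x0 : 'rV[k]_n.+1.
Hypothesis x0X : x0 \in X.
Hypothesis x0i : forall i, ~~ inC i -> x0 0 i != 0.

(* The hyperplane [x_i / x0_i = x_j / x0_j], the only one with support
   [{i, j}] passing through [x0]. *)
Definition graph_form i j : 'rV[k]_n.+1 := (x0 0 i)^-1 *: delta_mx 0 i - (x0 0 j)^-1 *: delta_mx 0 j.

(** Vanishing at x0 with a nonzero term in x_i forces a second nonzero term and fixes the ratio of
    the two coefficients. *)
Lemma inner_form a i : a \in A -> x0 \in hyperplane a -> ~~ inC i -> a 0 i != 0 ->
  exists j, [/\ j != i, ~~ inC j, a 0 j != 0, Defs.support a = [set i; j] &
    a = (a 0 i * x0 0 i) *: graph_form i j].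
Proof.
move=> aA xa iC ai; have [j ji aE] := two_coords aA ai.
move: xa; rewrite (mem_two_coords _ aE ji) => E.
have xi := x0i iC.
have aj : a 0 j != 0.
  by apply: contraTneq E => ->; rewrite mulr0 addr0 mulf_neq0.
have xj : x0 0 j != 0.
  by apply: contraTneq E => ->; rewrite mul0r addr0 mulf_neq0.
exists j; split=> //.
- by apply: contraNN xj => jC; rewrite (inCP jC x0X).
- apply/setP => m; rewrite !inE; have [->|mi] := eqVneq m i; first by rewrite ai.
  have [->|mj] := eqVneq m j; first by rewrite aj orbT.
  by rewrite aE !mxE !eqxx (negPf mi) (negPf mj) !mulr0 addr0 eqxx.
- rewrite {1}aE /graph_form scalerBr !scalerA mulfK // -scaleNr; congr (_ + _ *: _).
  apply: (mulIf xj); rewrite mulNr -mulrA mulVf // mulr1.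
  by apply/eqP; rewrite -addr_eq0 addrC mulrC [a 0 j * _]mulrC.
Qed.

Lemma mem_Gamma_members a : a \in Gamma_members A X ->
  [/\ a \in A, (X <= hyperplane a)%VS & exists2 i, ~~ inC i & a 0 i != 0].
Proof.
rewrite !mem_filter => /andP[aW /andP[Xa aA]]; split=> //.
apply: NNPP => h; move/negP: aW; apply; apply/mem_localization_W; split=> // i iC.
by apply/eqP; apply: NNPP => /negP ai; apply: h; exists i.
Qed.

Lemma Gamma_members_intro a i : a \in A -> (X <= hyperplane a)%VS -> ~~ inC i -> a 0 i != 0 ->
  a \in Gamma_members A X.
Proof.
move=> aA Xa iC ai; rewrite !mem_filter Xa aA !andbT; apply/negP => /mem_localization_W[_ /(_ i iC)/eqP].
by rewrite (negPf ai).
Qed.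

Lemma Gamma_edgeP i j : edge (Gamma A X) i j ->
  [/\ i != j, ~~ inC i, ~~ inC j & exists a c,
     [/\ a \in Gamma_members A X, Defs.support a = [set i; j], c != 0 & a = c *: graph_form i j]].
Proof.
case/andP => ij /hasP[a aG /eqP sa].
have [aA Xa [l lC al]] := mem_Gamma_members aG.
have xa : x0 \in hyperplane a by exact: (subvP Xa).
have [m [ml mC am sa' _]] := inner_form aA xa lC al.
have memC z : z \in Defs.support a -> ~~ inC z by rewrite sa' !inE => /orP[]/eqP->.
have iC : ~~ inC i by apply: memC; rewrite sa !inE eqxx.
have jC : ~~ inC j by apply: memC; rewrite sa !inE eqxx orbT.
have : i \in Defs.support a by rewrite sa !inE eqxx.
rewrite inE => ai; split=> //.
have [j' [j'i j'C aj' saj' aE]] := inner_form aA xa iC ai.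
have j'j : j' = j.
  have : j' \in [set i; j] by rewrite -sa saj' !inE eqxx orbT.
  by rewrite !inE (negPf j'i) => /eqP.
by exists a, (a 0 i * x0 0 i); rewrite -{2}j'j; split=> //; rewrite mulf_neq0 // x0i.
Qed.

Lemma Gamma_edge_sym : ssrbool.symmetric (edge (Gamma A X)).
Proof.
move=> i j; rewrite /= eq_sym; congr (_ && _); apply: eq_has => a /=.
by rewrite setUC.
Qed.

Lemma Gamma_edge_irr : irreflexive (edge (Gamma A X)).
Proof. by move=> i; rewrite /= eqxx. Qed.

End Flat.

End Hypertetrahedral.

(** * Local freeness implies freeness and chordality *)

Section MainProof.

Variables (k : closedFieldType) (n : nat) (A : seq 'rV[k]_n.+1).
Local Notation R := {mpoly k[n.+1]}.
Implicit Types (a b x : 'rV[k]_n.+1) (X : {vspace 'rV[k]_n.+1}).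

Hypothesis char0 : [pchar k] =i pred0.
Hypothesis arrA : arrangement A.
Hypothesis hyperA : forall a, a \in A ->
    exists i j : 'I_n.+1, (i < j)%N /\ (coord_codim2 k i j <= hyperplane a)%VS.

Lemma mdvd_pairing_scale (theta : 'rV[R]_n.+1) a d : d != 0 ->
  mdvd (linear_form (d *: a)) (pairing theta (d *: a)) <-> mdvd (linear_form a) (pairing theta a).
Proof.
move=> d0; rewrite mdvd_linear_form_scale // pairingZr; split; last exact: mdvdZ.
by move/(mdvdZ d^-1); rewrite scalerA mulVf // scale1r.
Qed.

Lemma mem_graph_form x0 x i j :
  (x \in hyperplane (graph_form x0 i j)) = ((x0 0 i)^-1 * x 0 i == (x0 0 j)^-1 * x 0 j).
Proof.
rewrite -meval_hyperplane linear_formE pairingBr !pairingZr !pairing_delta !mxE.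
by rewrite mevalB !mevalZ !mevalXU subr_eq0.
Qed.

Lemma graph_formC (x0 : 'rV[k]_n.+1) i j : graph_form x0 i j = - graph_form x0 j i.
Proof. by rewrite /graph_form opprB. Qed.

(** Applied to the hull W_X and to the space of points proportional to x0 along a cycle. *)
Lemma locally_free_flat (Y : 'rV[k]_n.+1 -> Prop) : locally_free_arrangement A ->
  (forall x y t, Y x -> Y y -> Y (x + t *: y)) -> (exists2 x, Y x & x != 0) ->
  exists2 A', (forall a, a \in A' <-> a \in A /\ forall x, Y x -> x \in hyperplane a) &
    locally_generated A' (fun=> 0).
Proof.
move=> lfA Ylin [y0 Yy0 /row_neq0P[l y0l]].
pose onY a := if excluded_middle_informative (forall x, Y x -> x \in hyperplane a) then true else false.
have onYP a : onY a <-> forall x, Y x -> x \in hyperplane a.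
  by rewrite /onY; case: excluded_middle_informative.
(* The coordinate form l is listed to keep p nonzero. *)
have [|b|p Yp pb] := @generic_point k n char0 Y (delta_mx 0 l :: [seq a <- A | ~~ onY a]) Ylin.
- by exists y0.
- rewrite inE mem_filter => /orP[/eqP->|/andP[/negP bY _]].
    by exists y0; rewrite ?mem_hyperplane_delta.
  apply: NNPP => h; apply: bY; apply/onYP => x Yx; apply: NNPP => /negP xb.
  by apply: h; exists x.
have p0 : exists i, p 0 i != 0.
  by exists l; rewrite -mem_hyperplane_delta; apply: pb; exact: mem_head.
have memP a : a \in through (fun i => p 0 i) A <->
    a \in A /\ forall x, Y x -> x \in hyperplane a.
  rewrite mem_filter meval_hyperplane; split=> [/andP[pa aA]|[aA /(_ p Yp) ->]//].
  split=> //; apply/onYP; apply: contraLR pa => aY.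
  by apply: pb; rewrite inE mem_filter aY aA orbT.
exists (through (fun i => p 0 i) A) => //.
apply: (@locally_generated_shift _ _ _ (fun i => p 0 i)).
  by move=> a; rewrite mem_filter => /andP[/eqP].
apply: locally_generated_through; exact: locally_free_generated.
Qed.

Lemma free_localization_W X : locally_free_arrangement A -> X != 0%VS ->
  free_arrangement (localization_W A X).
Proof.
move=> lfA X0; have arrW : arrangement (localization_W A X).
  by rewrite /localization_W; case: ifP => // _; exact: arrangement_filter.
apply/free_arrangementP => //; rewrite /localization_W in arrW *.
case: ifP => [hasC|_]; last exact: locally_generated_nil.
have [||A' A'P] := @locally_free_flat (fun x => x \in coord_hull X) lfA.
- by move=> x y t xX yX; rewrite memvD ?memvZ.
- exists (vpick X); last by rewrite vpick0.
  apply/memv_bigcap => i /subvP; apply; exact: memv_pick.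
apply: locally_generated_log_der => theta; split=> h a aA; apply: h.
  by apply/A'P; move: aA; rewrite mem_filter => /andP[/subvP Wa aA].
by rewrite mem_filter; have [-> Wa] := proj1 (A'P a) aA; rewrite andbT; apply/subvP.
Qed.

(** The space [Y] of points proportional to x0 along a chordless cycle isolates it: the hyperplanes
    of A containing Y are exactly its edges, which contradicts [cycle_not_free]. *)
Lemma chordal_Gamma X : locally_free_arrangement A -> chordal (Gamma A X).
Proof.
move=> lfA c cV cyc size_c; apply: NNPP => nochord.
have [x0 x0X x0i] := generic_flat_point char0 X.
have /andP[cyc_e uc] := cyc.
have edgeP := Gamma_edgeP arrA hyperA x0X x0i.
have nxe i : i \in c -> edge (Gamma A X) i (next c i) by exact: next_cycle.
have cC i : i \in c -> ~~ (X <= coord_hyperplane k i)%VS.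
  by move=> /nxe/edgeP[].
pose alpha i := (x0 0 i)^-1.
have alpha0 i : i \in c -> alpha i != 0 by move=> /cC/x0i; rewrite invr_eq0.
have i0c : head ord0 c \in c by case: (c) size_c => //= i c' _; exact: mem_head.
pose Y (z : 'rV[k]_n.+1) := forall i j, i \in c -> j \in c -> z 0 i * x0 0 j = z 0 j * x0 0 i.
have [||A' A'P A'gen] := @locally_free_flat Y lfA.
- move=> x y t Yx Yy i j ic jc; rewrite !mxE !mulrDl (Yx i j) // -!mulrA (Yy i j) //.
- exists x0; first by move=> i j _ _; rewrite mulrC.
  by apply: contraNneq (x0i _ (cC _ i0c)) => ->; rewrite mxE.
have A'0 a : a \in A' -> a != 0 by case/A'P => aA _; exact: arrangement_neq0 aA.
have formE i : cycle_form c alpha i = graph_form x0 i (next c i) by [].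
have edge_form i : i \in c -> exists a d, [/\ a \in A, (X <= hyperplane a)%VS, d != 0 &
    a = d *: graph_form x0 i (next c i)].
  move=> ic; have [_ _ _ [a [d [aG _ d0 aE]]]] := edgeP _ _ (nxe i ic).
  by have [aA Xa _] := mem_Gamma_members arrA aG; exists a, d.
suff AP theta : log_der A' theta <-> forall i, i \in c ->
    mdvd (linear_form (cycle_form c alpha i)) (pairing theta (cycle_form c alpha i)).
  exact: (cycle_not_free uc size_c alpha0 i0c AP A'gen).
split=> [thA i ic|h a aA'].
  have [a [d [aA _ d0 aE]]] := edge_form i ic.
  apply/(mdvd_pairing_scale _ _ d0); rewrite formE -aE; apply: thA.
  apply/A'P; split=> // z Yz; rewrite aE hyperplane_scale // mem_graph_form.
  have nc : next c i \in c by rewrite mem_next.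
  have xi := x0i _ (cC _ ic); have xn := x0i _ (cC _ nc).
  by rewrite ![_^-1 * _]mulrC eqr_div // Yz.
have [aA aY] := proj1 (A'P a) aA'.
(* Coordinate vectors off the cycle lie in Y. *)
have a_c i : a 0 i != 0 -> i \in c.
  apply: contraNT => ic; rewrite -delta_mem_hyperplane; apply: aY => i' j' i'c j'c.
  have neq m : m \in c -> (m == i) = false by move=> mc; apply/negbTE; apply: contraNneq ic => <-.
  by rewrite !mxE !neq // !mul0r.
have [l al] := row_neq0P (A'0 a aA').
have lc := a_c _ al.
have x0a : x0 \in hyperplane a by apply: aY => i j _ _; rewrite mulrC.
have [j [jl jC aj sa aE]] := inner_form hyperA x0X x0i aA x0a (cC _ lc) al.
have jc := a_c _ aj.
have d0 : a 0 l * x0 0 l != 0 by rewrite mulf_neq0 // x0i // cC.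
(* All edges of the cycle contain X, so the ratios x_i / x0_i agree along the cycle on X; hence [a]
   contains X and is an edge of Gamma. *)
have Xa : (X <= hyperplane a)%VS.
  apply/subvP => x xX; rewrite aE hyperplane_scale // mem_graph_form.
  have const i : i \in c -> (x0 0 i)^-1 * x 0 i = (x0 0 l)^-1 * x 0 l.
    move: i; apply: (next_ind uc lc) => // i ic <-.
    have [b [d [_ /subvP/(_ x xX) Xb d0' bE]]] := edge_form i ic.
    by move: Xb; rewrite bE hyperplane_scale // mem_graph_form => /eqP.
  by rewrite (const j).
have elj : edge (Gamma A X) l j.
  rewrite /= eq_sym jl; apply/hasP; exists a; last by rewrite sa.
  exact: Gamma_members_intro (cC _ lc) al.
(* Without chords the edge belongs to the cycle, in one of two orientations. *)
have [jE|jE] := eqVneq j (next c l).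
  by rewrite aE; apply/mdvd_pairing_scale => //; rewrite jE -formE; exact: h.
have [lE|lE] := eqVneq l (next c j); last by case: nochord; exists l, j.
rewrite aE graph_formC scalerN -scaleNr; apply/mdvd_pairing_scale; first by rewrite oppr_eq0.
by rewrite lE -formE; exact: h.
Qed.

End MainProof.

(** * Freeness and chordality imply local freeness *)

Section Backward.

Variables (k : closedFieldType) (n : nat) (A : seq 'rV[k]_n.+1).
Local Notation R := {mpoly k[n.+1]}.
Implicit Types (a b x : 'rV[k]_n.+1) (X : {vspace 'rV[k]_n.+1}).

Hypothesis char0 : [pchar k] =i pred0.
Hypothesis arrA : arrangement A.
Hypothesis hyperA : forall a, a \in A ->
    exists i j : 'I_n.+1, (i < j)%N /\ (coord_codim2 k i j <= hyperplane a)%VS.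

Lemma Gamma_vertices X a i : a \in Gamma_members A X -> a 0 i != 0 -> i \in vertices (Gamma A X).
Proof.
move=> aG ai; rewrite /=; elim: (Gamma_members A X) aG => // b s IH.
rewrite inE big_cons => /orP[/eqP<-|/IH h]; rewrite inE ?h ?orbT //.
by rewrite inE ai.
Qed.

(* Removing a simplicial vertex, induction gives the hyperplanes off [v]; those
   through [v] are pairwise congruent modulo them, so interpolation applies. *)
Lemma localization_generated X : chordal (Gamma A X) ->
  locally_generated (localization_W A X) (fun=> 0) ->
  locally_generated (localization A X) (fun=> 0).
Proof.
move=> chordX genW; have [x0 x0X x0i] := generic_flat_point char0 X.
have edgeP := Gamma_edgeP arrA hyperA x0X x0i.
pose mem_on (T : {set 'I_n.+1}) := [seq a <- Gamma_members A X | Defs.support a \subset T].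
have memT T a : a \in mem_on T <-> a \in Gamma_members A X /\ forall i, a 0 i != 0 -> i \in T.
  rewrite mem_filter; split=> [/andP[/subsetP aT aG]|[aG aT]].
    by split=> // i ai; apply: aT; rewrite inE.
  by rewrite aG andbT; apply/subsetP => i; rewrite inE; exact: aT.
(* [T] interpolates between the empty set, which gives A_{W_X}, and the set of all vertices, which
   gives A_X. *)
suff step m (T : {set 'I_n.+1}) : (#|T| <= m)%N -> T \subset vertices (Gamma A X) ->
    locally_generated (localization_W A X ++ mem_on T) (fun=> 0).
  apply: locally_generated_log_der (step _ _ (leqnn _) (subxx _)) => theta.
  split=> h a aX; apply: h.
    rewrite mem_cat; have [//|aW] := boolP (a \in localization_W A X).
    have aG : a \in Gamma_members A X by rewrite mem_filter aW.
    by apply/orP; right; apply/memT; split=> // i; exact: Gamma_vertices.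
  move: aX; rewrite mem_cat => /orP[/(mem_localization_W arrA)[aA a0]|/memT[]]; last first.
    by case/(mem_Gamma_members arrA) => aA Xa _; rewrite mem_filter Xa.
  rewrite mem_filter aA andbT; apply/subvP => x xX; rewrite mem_hyperplane big1 // => i _.
  have [iC|/a0->] := boolP (X <= coord_hyperplane k i)%VS; last by rewrite mulr0.
  by rewrite (inCP iC xX) mul0r.
elim: m T => [|m IH] T Tm TV.
  apply: locally_generated_log_der genW => theta; split=> h a.
    rewrite mem_cat => /orP[|/memT[/(mem_Gamma_members arrA)[_ _ [i _ ai]] /(_ i ai)]]; first exact: h.
    by move: Tm; rewrite leqn0 cards_eq0 => /eqP ->; rewrite inE.
  by move=> aW; apply: h; rewrite mem_cat aW.
have [T0|T0] := eqVneq T set0; first by rewrite T0; apply: IH; rewrite ?cards0 ?sub0set.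
have [v vT simv] := simplicial_exists (@Gamma_edge_sym _ _ A X) (@Gamma_edge_irr _ _ A X) chordX TV T0.
have vC : ~~ (X <= coord_hyperplane k v)%VS.
  have [b bG bv] : exists2 b, b \in Gamma_members A X & b 0 v != 0.
    move: (subsetP TV v vT); rewrite /=; elim: (Gamma_members A X) => [|b s IHs].
      by rewrite big_nil inE.
    rewrite big_cons inE => /orP[bv|/IHs[b' b's b'v]].
      by exists b; [exact: mem_head|move: bv; rewrite inE].
    by exists b' => //; rewrite inE b's orbT.
  have [bA Xb [l lC bl]] := mem_Gamma_members arrA bG.
  have [j [_ jC _ sb _]] := inner_form hyperA x0X x0i bA (subvP Xb _ x0X) lC bl.
  have : v \in Defs.support b by rewrite inE.
  by rewrite sb !inE => /orP[]/eqP->.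
pose T' := T :\ v.
have T'm : (#|T'| <= m)%N by move: Tm; rewrite (cardsD1 v T) vT.
have T'V : T' \subset vertices (Gamma A X) by exact: subset_trans (subsetDl _ _) TV.
have genT' := IH T' T'm T'V.
pose lam u := x0 0 v / x0 0 u.
pose ev u : 'rV[k]_n.+1 := delta_mx 0 v - lam u *: delta_mx 0 u.
pose nb := [seq u <- enum T | edge (Gamma A X) v u].
pose E := [seq ev u | u <- nb].
have nbP u : u \in nb <-> u \in T /\ edge (Gamma A X) v u.
  by rewrite mem_filter mem_enum; split=> [/andP[]|[-> ->]].
have nbv u : u \in nb -> [/\ u != v, x0 0 u != 0, x0 0 v != 0 & lam u != 0].
  case/nbP => uT /edgeP[vu _ uC _]; have xv := x0i _ vC; have xu := x0i _ uC.
  by split=> //; [rewrite eq_sym|rewrite mulf_neq0 ?invr_eq0].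
have evE u j : ev u 0 j = (j == v)%:R - lam u * (j == u)%:R by rewrite !mxE eqxx.
have ev_form u : u \in nb -> ev u = x0 0 v *: graph_form x0 v u.
  case/nbv => _ xu xv _; rewrite /ev /graph_form scalerBr !scalerA divff // scale1r.
  by [].
have ev_diff u w : u \in nb -> w \in nb -> ev w - ev u = x0 0 v *: graph_form x0 u w.
  move=> uN wN; rewrite !ev_form // -scalerBr; congr (_ *: _).
  by rewrite /graph_form opprB addrC addrA addrNK.
have ev_inj : {in nb &, injective ev}.
  move=> u w uN wN /rowP/(_ u); rewrite !evE eqxx; have [uv _ _ lu] := nbv u uN.
  rewrite (negPf uv) !sub0r mulr1 => /oppr_inj.
  by have [//|_] := eqVneq u w; rewrite mulr0 => /eqP; rewrite (negPf lu).
have genE : locally_generated (E ++ (localization_W A X ++ mem_on T')) (fun=> 0).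
  apply: (@locally_generated_add _ _ v) genT'.
  - move=> a; rewrite mem_cat => /orP[/(mem_localization_W arrA)[_]|/memT[_ aT']].
      by apply.
    by apply/eqP; apply: NNPP => /negP av; have := aT' v av; rewrite !inE eqxx.
  - by rewrite (map_inj_in_uniq ev_inj); apply/filter_uniq/enum_uniq.
  - move=> _ /mapP[u uN ->]; have [uv _ _ _] := nbv u uN.
    by rewrite evE eqxx eq_sym (negPf uv) mulr0 subr0.
  - move=> _ _ _ /mapP[u uN ->] /mapP[w wN ->] /mapP[z zN ->] wu zu.
    have wu' : w != u by apply: contraNneq wu => ->; rewrite eqxx.
    have zu' : z != u by apply: contraNneq zu => ->; rewrite eqxx.
    move/linear_form_mdvd => [|d dE]; first by rewrite subr_eq0.
    have [->//|wz] := eqVneq w z.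
    have [wv _ _ lw] := nbv w wN.
    have := congr1 (fun r : 'rV[k]_n.+1 => r 0 w) dE; rewrite !mxE !eqxx /=.
    rewrite (negPf wv) (negPf wz) (negPf wu') !mulr0 !subr0 sub0r mulr1.
    move/eqP; rewrite eq_sym mulf_eq0 oppr_eq0 (negPf lw) orbF => /eqP d0.
    by move/eqP: dE; rewrite d0 scale0r subr_eq0 (negPf zu).
  - move=> theta _ _ thA /mapP[u uN ->] /mapP[w wN ->] uw.
    have uw' : u != w by apply: contraNneq uw => ->; rewrite eqxx.
    have [uv _ xv _] := nbv u uN; have [wv _ _ _] := nbv w wN.
    have [uT vu] := proj1 (nbP u) uN; have [wT vw] := proj1 (nbP w) wN.
    (* Simpliciality: the difference of the two forms is, up to a scalar, the edge between the two
       neighbours, which avoids v and is already present. *)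
    have [_ _ _ [a [d [aG sa d0 aE]]]] := edgeP _ _ (simv u w uT wT vu vw uw').
    rewrite ev_diff //; apply/(mdvd_pairing_scale _ _ xv)/(mdvd_pairing_scale _ _ d0).
    rewrite -aE; apply: thA; rewrite mem_cat; apply/orP; right; apply/memT; split=> // i.
    move=> ai; have : i \in Defs.support a by rewrite inE.
    by rewrite sa !inE => /orP[]/eqP->; rewrite ?uv ?uT ?wv ?wT.
apply: locally_generated_log_der genE => theta; split=> h a.
  rewrite mem_cat => /orP[aW|/memT[aG aT]]; first by apply: h; rewrite !mem_cat aW orbT.
  have [av|av] := eqVneq (a 0 v) 0.
    apply: h; rewrite !mem_cat; apply/orP; right; apply/orP; right; apply/memT; split=> // i ai.
    by rewrite !inE aT // andbT; apply: contraNneq ai => ->; rewrite av.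
  have [aA Xa [l lC al]] := mem_Gamma_members arrA aG.
  have x0a : x0 \in hyperplane a by exact: (subvP Xa).
  have [j [jv jC aj sa aE]] := inner_form hyperA x0X x0i aA x0a vC av.
  have jN : j \in nb.
    apply/nbP; split; first exact: aT.
    by rewrite /= eq_sym jv; apply/hasP; exists a; rewrite ?sa.
  have [_ _ xv _] := nbv j jN.
  rewrite aE; apply/mdvd_pairing_scale; first by rewrite mulf_neq0.
  apply/(mdvd_pairing_scale _ _ xv); rewrite -ev_form //; apply: h.
  by rewrite mem_cat; apply/orP; left; exact: map_f.
rewrite !mem_cat => /orP[/mapP[u uN ->]|/orP[aW|/memT[aG aT']]].
- have [uv _ xv _] := nbv u uN; have [uT vu] := proj1 (nbP u) uN.
  have [_ _ _ [a' [d [aG sa d0 aE]]]] := edgeP _ _ vu.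
  rewrite ev_form //; apply/(mdvd_pairing_scale _ _ xv)/(mdvd_pairing_scale _ _ d0).
  rewrite -aE; apply: h; rewrite mem_cat; apply/orP; right; apply/memT; split=> // i ai.
  have : i \in Defs.support a' by rewrite inE.
  by rewrite sa !inE => /orP[]/eqP->.
- by apply: h; rewrite mem_cat aW.
- apply: h; rewrite mem_cat; apply/orP; right; apply/memT; split=> // i /aT'.
  by rewrite inE => /andP[].
Qed.

(** The flat attached to a point p of Proj is the intersection X of the hyperplanes whose forms lie
    in p. By duality every form vanishing on X lies in p, so A_X consists of just these hyperplanes,
    and X is nonempty because p omits a variable. *)
Lemma locally_free_of_flats :
  (forall X, intersection_lattice A X ->
     free_arrangement (localization_W A X) /\ chordal (Gamma A X)) ->
  locally_free_arrangement A.
Proof.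
move=> flatsA; apply: locally_free_of_points => // p.
pose onp a := if excluded_middle_informative (p (linear_form a)) then true else false.
have onpP a : onp a <-> p (linear_form a).
  by rewrite /onp; case: excluded_middle_informative.
pose A1 := [seq a <- A | onp a].
exists A1; first by move=> a; rewrite mem_filter andbC; split=> [/andP[? /onpP]|[-> /onpP]].
have [A10|A1n] := eqVneq A1 [::]; first by rewrite A10; exact: locally_generated_nil.
pose X := (\bigcap_(b <- A1) hyperplane b)%VS.
have pA1 b : b \in A1 -> p (linear_form b) by rewrite mem_filter => /andP[/onpP].
have Xp a : (X <= hyperplane a)%VS -> p (linear_form a) by exact: linear_form_dual.
have LX : intersection_lattice A X.
  exists A1; split=> //; first by move=> a; rewrite mem_filter => /andP[].
  apply/eqP => X0; have [i] := ideal_relevant p; apply.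
  by rewrite -linear_form_delta; apply: Xp; rewrite X0 sub0v.
have [freeW chordX] := flatsA X LX.
have arrW : arrangement (localization_W A X).
  by rewrite /localization_W; case: ifP => // _; exact: arrangement_filter.
have gen := localization_generated chordX (proj1 (free_arrangementP arrW) freeW).
apply: locally_generated_log_der gen => theta; split=> h a; rewrite mem_filter => /andP[a1 aA].
  apply: h; rewrite mem_filter aA andbT; apply/subvP => x /memv_bigcap_seq; apply.
  by rewrite mem_filter a1.
apply: h; rewrite mem_filter aA andbT; apply/onpP; exact: Xp.
Qed.

End Backward.

Theorem corollary3p10 (k : closedFieldType) (char0 : [pchar k] =i pred0)
    (n : nat) (s : 'I_n.+1 -> 'I_n.+1 -> nat)
    (s_ge1 : forall i j : 'I_n.+1, (i < j)%N -> (1 <= s i j)%N)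
    (A : seq 'rV[k]_n.+1) (HA : hypertetrahedral_class s A) :
  locally_free_arrangement A <->
  (forall X : {vspace 'rV[k]_n.+1}, intersection_lattice A X ->
     free_arrangement (localization_W A X) /\ chordal (Gamma A X)).
Proof.
have [[[arrA hyperA] _] _] := HA.
split=> [lfA X [_ [_ _ _ X0]]|]; last exact: locally_free_of_flats.
by split; [exact: free_localization_W|exact: chordal_Gamma].
Qed.
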